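(* Let $V\subseteq{}^*\Omega_c$ be internal and let $\Gamma\subseteq{}^*\mathbb R^d$ be an internal cone. Let $u\in\mathcal M({}^*\Omega_c)$ be $\mathcal M^\infty$-microlocally regular at $(x_0,\xi_0)$ for each $x_0\in V$ and each $\xi_0\in{}^*\mathbf S\cap\Gamma$. Then there exists $k\in{}^*\mathbb N_\infty$ such that $\widehat{\phi_{k,x}u}(\xi)\approxeq 0$ for each $x\in V$ and each $\xi\in\Gamma\cap{}^*\mathbb R^d_{fs}$.
   Context: Internal objects. Let $I=(0,1]$. For a nonempty set $A$ (a subset of $\mathbb R^d$ or $\mathbb C$), ${}^*A:=A^I/\!\sim$, where $(x_\varepsilon)_\varepsilon\sim(y_\varepsilon)_\varepsilon$ iff $x_\varepsilon=y_\varepsilon$ for all sufficiently small $\varepsilon$ (''for small $\varepsilon$''); classes are written $[x_\varepsilon]$, and $a\in A$ is identified with the class of the constant family. Functions and operations are extended $\varepsilon$-wise; a relation such as $\le,<$ holds between $[x_\varepsilon]$ and $[y_\varepsilon]$ iff it holds between $x_\varepsilon$ and $y_\varepsilon$ for small $\varepsilon$ (so the order on ${}^*\mathbb R$ is partial). For nonempty $A_\varepsilon\subseteq\mathbb R^d$, $[A_\varepsilon]:=\{[x_\varepsilon]:x_\varepsilon\in A_\varepsilon\text{ for small }\varepsilon\}$; subsets of ${}^*\mathbb R^d$ of this form are called internal. For a set $X$ of functions $\mathbb R^d\to\mathbb C$, ${}^*X$ is the set of maps $[f_\varepsilon]:{}^*\mathbb R^d\to{}^*\mathbb C$, $[x_\varepsilon]\mapsto[f_\varepsilon(x_\varepsilon)]$,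 with $f_\varepsilon\in X$ for small $\varepsilon$; derivatives $\partial^\alpha$, integrals and the Fourier transform $\widehat{\ \cdot\ }$ are taken $\varepsilon$-wise. ${}^*\mathbb N_\infty$ is the set of $m\in{}^*\mathbb N$ with $m\ge n$ for all $n\in\mathbb N$. Let $\rho:=[\varepsilon]\in{}^*\mathbb R$. An element $x$ of ${}^*\mathbb R^d$ or ${}^*\mathbb C$ is moderate if $|x|\le\rho^{-N}$ for some $N\in\mathbb N$, and negligible ($x\approxeq0$) if $|x|\le\rho^n$ for each $n\in\mathbb N$; ${}^*\mathbb C_{\mathcal M}$ is the set of moderate elements of ${}^*\mathbb C$. ${}^*\mathbb R^d_{fs}:=\{x\in{}^*\mathbb R^d:(\exists a\in\mathbb R_{>0})\,|x|\ge\rho^{-a}\}$. Write $x\approx_{\mathrm{fast}}y$ if $|x-y|\le\rho^a$ for some $a\in\mathbb R_{>0}$. $\Omega\subseteq\mathbb R^d$ is open, and ${}^*\Omega_c:=\bigcup_K{}^*K$ over nonempty compact $K\subset\Omega$. For $A\subseteq{}^*\mathbb R^d$, $\mathcal M(A):=\{u\in{}^*(\mathcal C^\infty(\mathbb R^d)):\partial^\alpha u(x)\in{}^*\mathbb C_{\mathcal M}\ \forall\alpha\in\mathbb N^d,\forall x\in A\}$. Let $\mathcal K(\mathbb R^d)$ be the set of nonempty compact subsets of $\mathbb R^d$ and ${}^*(\mathcal K(\mathbb R^d)):=\{[K_\varepsilon]:K_\varepsilon\in\mathcal K(\mathbb R^d)\text{ for small }\varepsilon\}$. $u$ is compactly supported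 in $A$ if there is $K\in{}^*(\mathcal K(\mathbb R^d))$, $K\subseteq A$, such that $u(x)=0$ for every $x\in{}^*\mathbb R^d$ with $|x-a|>0$ for all $a\in K$. $\mathcal M_c(A)$ is the set of $u\in\mathcal M({}^*\mathbb R^d)$ compactly supported in $A$. $\mathbf S:=\{x\in\mathbb R^d:|x|=1\}$. $u\in\mathcal M({}^*\Omega_c)$ is $\mathcal M^\infty$-microlocally regular at $(x_0,\xi_0)\in{}^*\Omega_c\times{}^*\mathbf S$ if there is $v\in\mathcal M_c({}^*\Omega_c)$ with $u(x)=v(x)$ for all $x\approx_{\mathrm{fast}}x_0$ and $\widehat v(\xi)\approxeq0$ for all $\xi\in{}^*\mathbb R^d_{fs}$ with $\frac{\xi}{|\xi|}\approx_{\mathrm{fast}}\xi_0$. A cone in ${}^*\mathbb R^d$ has vertex $0$, i.e. it is closed under multiplication by elements of ${}^*\mathbb R_{>0}$. Fix $\phi_0\in\mathcal D(B(0,1))$ (smooth, compactly supported) with $0\le\phi_0\le1$ and $\phi_0=1$ on $B(0,1/2)$; for $m\in{}^*\mathbb N$, $m\ge1$, and $x_0\in{}^*\mathbb R^d$, $\phi_{m,x_0}(x):=\phi_0\bigl(\frac{x-x_0}{\rho^{1/m}}\bigr)$. *)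

(* Defs.v *)
(* MathComp-Analysis, over an abstract [R : realType]. *)
From HB Require Import structures.
From mathcomp Require Import all_boot all_order all_algebra.
From mathcomp Require Import generic_quotient complex.
From mathcomp Require Import all_classical all_reals all_analysis.

Set Implicit Arguments.
Unset Strict Implicit.
Unset Printing Implicit Defensive.

Import Order.TTheory GRing.Theory Num.Theory.
Import numFieldNormedType.Exports.

Local Open Scope classical_set_scope.
Local Open Scope ring_scope.
Local Open Scope complex_scope.
Local Open Scope quotient_scope.

Section Hyper.
Variable R : realType.

Definition eps_index : Type := {e : R | 0 < e <= 1}.

Definition for_small (P : eps_index -> Prop) : Prop :=
  exists2 eta : R, 0 < eta & forall e : eps_index, sval e <= eta -> P e.

Lemma for_smallT (P : eps_index -> Prop) : (forall e, P e) -> for_small P.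
Proof. by move=> hP; exists 1. Qed.

Lemma for_smallS (P Q : eps_index -> Prop) :
  (forall e, P e -> Q e) -> for_small P -> for_small Q.
Proof. by move=> PQ [eta eta0 hP]; exists eta => // e /hP /PQ. Qed.

Lemma for_smallI (P Q : eps_index -> Prop) :
  for_small P -> for_small Q -> for_small (fun e => P e /\ Q e).
Proof.
move=> [a a0 hP] [b b0 hQ]; exists (Num.min a b).
  by rewrite lt_min a0.
by move=> e; rewrite le_min => /andP[ea eb]; split; [exact: hP|exact: hQ].
Qed.

Section HyperType.
Variable T : Type.

Definition germ_rel : rel {classic (eps_index -> T)} :=
  fun x y => `[< for_small (fun e => x e = y e) >].

Lemma germ_rel_refl : reflexive germ_rel.
Proof. by move=> x; apply/asboolP; exact: for_smallT. Qed.

Lemma germ_rel_sym : symmetric germ_rel.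
Proof.
by move=> x y; apply/asboolP/asboolP; apply: for_smallS => e ->.
Qed.

Lemma germ_rel_trans : transitive germ_rel.
Proof.
move=> y x z /asboolP xy /asboolP yz; apply/asboolP.
by apply: for_smallS (for_smallI xy yz) => e [-> ->].
Qed.

Canonical germ_equiv :=
  EquivRel germ_rel germ_rel_refl germ_rel_sym germ_rel_trans.

Definition hyper : Type := {eq_quot germ_equiv}.

Definition cls (x : eps_index -> T) : hyper :=
  \pi_({eq_quot germ_equiv}) (x : {classic (eps_index -> T)}).

Definition rep (x : hyper) : eps_index -> T :=
  (repr (x : {eq_quot germ_equiv}) : {classic (eps_index -> T)}).

Definition hcst (a : T) : hyper := cls (fun=> a).

Lemma repK (x : hyper) : cls (rep x) = x.
Proof. exact: reprK. Qed.

Lemma cls_eqP (x y : eps_index -> T) :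
  cls x = cls y <-> for_small (fun e => x e = y e).
Proof.
rewrite /cls; split=> [/eqmodP/asboolP//|xy].
by apply/eqmodP/asboolP.
Qed.

Lemma rep_cls (x : eps_index -> T) : for_small (fun e => rep (cls x) e = x e).
Proof. by apply/cls_eqP; rewrite repK. Qed.

End HyperType.

(* Choosing representatives is harmless in the next four definitions, by [hmapE],
   [hmap2E], [hpredE] and [hrelE]. *)

Definition hmap (A B : Type) (f : A -> B) (x : hyper A) : hyper B :=
  cls (fun e => f (rep x e)).

Definition hmap2 (A B C : Type) (f : A -> B -> C)
    (x : hyper A) (y : hyper B) : hyper C :=
  cls (fun e => f (rep x e) (rep y e)).

Definition hpred (A : Type) (P : A -> Prop) (x : hyper A) : Prop :=
  for_small (fun e => P (rep x e)).

Definition hrel (A B : Type) (P : A -> B -> Prop)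
    (x : hyper A) (y : hyper B) : Prop :=
  for_small (fun e => P (rep x e) (rep y e)).

Lemma hmapE (A B : Type) (f : A -> B) (x : eps_index -> A) :
  hmap f (cls x) = cls (fun e => f (x e)).
Proof. by apply/cls_eqP; apply: for_smallS (rep_cls x) => e ->. Qed.

Lemma hmap2E (A B C : Type) (f : A -> B -> C) (x : eps_index -> A)
    (y : eps_index -> B) :
  hmap2 f (cls x) (cls y) = cls (fun e => f (x e) (y e)).
Proof.
apply/cls_eqP; apply: for_smallS (for_smallI (rep_cls x) (rep_cls y)) => e.
by move=> [-> ->].
Qed.

Lemma hpredE (A : Type) (P : A -> Prop) (x : eps_index -> A) :
  hpred P (cls x) <-> for_small (fun e => P (x e)).
Proof.
split=> h; apply: for_smallS (for_smallI h (rep_cls x)) => e [].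
  by move=> + <-.
by move=> + ->.
Qed.

Lemma hrelE (A B : Type) (P : A -> B -> Prop) (x : eps_index -> A)
    (y : eps_index -> B) :
  hrel P (cls x) (cls y) <-> for_small (fun e => P (x e) (y e)).
Proof.
have h0 := for_smallI (rep_cls x) (rep_cls y).
split=> h; apply: for_smallS (for_smallI h h0) => e [].
  by move=> + [<- <-].
by move=> + [-> ->].
Qed.

(* An internal map [x_eps] |-> [f_eps(x_eps)] is encoded by the germ of the family
   (f_eps) and acts by [happ]; by [happ_inj] germ and map determine each other, so
   operations such as derivatives may be defined on the germ. *)

Definition happ (A B : Type) (u : hyper (A -> B)) (x : hyper A) : hyper B :=
  hmap2 (fun f a => f a) u x.

Lemma happ_inj (A B : Type) (a0 : A) : injective (@happ A B).
Proof.
move=> u v uv; rewrite -(repK u) -(repK v); apply/cls_eqP.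
pose x e := if pselect (exists a, rep u e a <> rep v e a) is left h
  then sval (cid h) else a0.
have := congr1 (fun w => w (cls x)) uv.
rewrite /happ -{1}(repK u) -{1}(repK v) !hmap2E => /cls_eqP.
apply: for_smallS => e; rewrite /x; case: pselect => [h|h _].
  by case: cid => a /= ? /esym; congruence.
by apply/funext => a; apply: contrapT => ne; apply: h; exists a.
Qed.

(* The internal set [A_eps], where (A_eps) is only known up to germ equality. *)

Definition hset (A : Type) (B : hyper (set A)) : set (hyper A) :=
  [set x | hrel (fun a b => b a) x B].

Definition internal (A : Type) (X : set (hyper A)) : Prop :=
  exists2 B : hyper (set A), hpred (fun b => b !=set0) B & X = hset B.

Definition hstar (A : Type) (B : set A) : set (hyper A) := hset (hcst B).

Definition hle (x y : hyper R) : Prop := hrel (fun a b : R => a <= b) x y.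
Definition hlt (x y : hyper R) : Prop := hrel (fun a b : R => a < b) x y.

Definition hnat_infty : set (hyper nat) :=
  [set m | forall n : nat, hrel (fun a b => (a <= b)%N) (hcst n) m].

Definition rho : hyper R := cls (fun e => sval e).

Definition rho_pow (a : R) : hyper R := hmap (fun r => r `^ a) rho.

Definition hmoderate (z : hyper R[i]) : Prop :=
  exists N : nat, hle (hmap (@Normc.normc R) z) (rho_pow (- N%:R)).

Definition hnegligible (z : hyper R[i]) : Prop :=
  forall n : nat, hle (hmap (@Normc.normc R) z) (rho_pow n%:R).

End Hyper.

Section Euclidean.
Variables (R : realType) (d : nat).
Local Notation E := 'rV[R]_d.

Definition dotp (x y : E) : R := \sum_(i < d) x 0 i * y 0 i.

(* The library's norm on ['rV[R]_d] is the sup norm. *)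
Definition enorm (x : E) : R := Num.sqrt (dotp x x).

Definition ball_e (r : R) : set E := [set x | enorm x < r].
Definition sphere_e : set E := [set x | enorm x = 1].

Definition pderive (i : 'I_d) (f : E -> R) : E -> R :=
  fun x => 'D_(delta_mx 0 i) f x.

(* Lists of directions, rather than multi-indices, so that mixed partial derivatives
   in every order are required to exist and to be continuous. *)
Definition smooth (f : E -> R) : Prop :=
  forall s : seq 'I_d,
    let g := foldr pderive f s in
    continuous g /\ forall (i : 'I_d) (x : E), derivable g x (delta_mx 0 i).

Definition mderive (alpha : 'I_d -> nat) (f : E -> R) : E -> R :=
  foldr (fun i g => iter (alpha i) (pderive i) g) f (enum 'I_d).

Definition csmooth (f : E -> R[i]) : Prop :=
  smooth (fun x => complex.Re (f x)) /\ smooth (fun x => complex.Im (f x)).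

Definition cmderive (alpha : 'I_d -> nat) (f : E -> R[i]) : E -> R[i] :=
  fun x => mderive alpha (fun y => complex.Re (f y)) x
        +i* mderive alpha (fun y => complex.Im (f y)) x.

(* The support condition amounts to a compact support inside the open unit ball. *)
Definition test_function_unit_ball (f : E -> R) : Prop :=
  smooth f /\ exists K : set E,
    [/\ compact K, K `<=` ball_e 1 & forall x, ~ K x -> f x = 0].

End Euclidean.

Lemma prod_sigma_finite d1 d2 (T1 : measurableType d1) (T2 : measurableType d2)
    (R : realType) (m1 : {sigma_finite_measure set T1 -> \bar R})
    (m2 : {sigma_finite_measure set T2 -> \bar R}) :
  sigma_finite setT (m1 \x m2)%E.
Proof.
have /sigma_finiteP[F [TF ndF Foo]] := sigma_finiteT m1.
have /sigma_finiteP[G [TG ndG Goo]] := sigma_finiteT m2.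
exists (fun n => F n `*` G n).
  rewrite -setXTT TF TG predeqE => -[x y]; split.
    move=> [/= [n _ Fnx] [k _ Gky]]; exists (maxn n k) => //; split.
    - by move: x Fnx; exact/subsetPset/ndF/leq_maxl.
    - by move: y Gky; exact/subsetPset/ndG/leq_maxr.
  by move=> [n _ []/= ? ?]; split; exists n.
move=> k; have [? ?] := Foo k; have [? ?] := Goo k.
split; first exact: measurableX.
by rewrite product_measure1E// lte_mul_pinfty// ge0_fin_numE.
Qed.

Section Lebesgue.
Variable R : realType.
Local Notation mR := (measurableTypeR R).

Definition tcons (n : nat) (p : mR * n.-tuple mR) : n.+1.-tuple mR :=
  [the n.+1.-tuple mR of p.1 :: p.2].

Definition tuncons (n : nat) (t : n.+1.-tuple mR) : mR * n.-tuple mR :=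
  (thead t, [tuple of behead t]).

Lemma tconsK n : cancel (@tcons n) (@tuncons n).
Proof. by case=> x t; congr pair; exact: val_inj. Qed.

Lemma measurable_tcons n : measurable_fun setT (@tcons n).
Proof.
exact: (@measurable_cons _ _ _ _ fst n snd measurable_fst measurable_snd).
Qed.

Lemma measurable_tuncons n : measurable_fun setT (@tuncons n).
Proof.
apply: measurable_fun_pair; first exact: (measurable_tnth ord0).
exact: measurable_behead.
Qed.

Section Step.
Variables (n : nat) (l : {sigma_finite_measure set mR -> \bar R}).
Variable m : {sigma_finite_measure set (n.-tuple mR) -> \bar R}.

Definition leb_step : set (n.+1.-tuple mR) -> \bar R :=
  pushforward (l \x m)%E (@tcons n).

Let leb_step0 : leb_step set0 = 0%E.
Proof. by rewrite /leb_step /pushforward preimage_set0 measure0. Qed.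

Let leb_step_ge0 A : (0 <= leb_step A)%E.
Proof. by rewrite /leb_step /pushforward measure_ge0. Qed.

Let leb_step_sigma_additive : semi_sigma_additive leb_step.
Proof.
move=> F mF tF mUF; rewrite /leb_step /pushforward preimage_bigcup.
apply: measure_semi_sigma_additive.
- by move=> i; rewrite -[X in measurable X]setTI; exact: measurable_tcons.
- by apply/trivIsetP => i j _ _ ij; rewrite -preimage_setI;
    move/trivIsetP : tF => -> //; exact: preimage_set0.
- by rewrite -preimage_bigcup -[X in measurable X]setTI;
    exact: measurable_tcons.
Qed.

HB.instance Definition _ := isMeasure.Build _ _ _ leb_step
  leb_step0 leb_step_ge0 leb_step_sigma_additive.

Let leb_step_sigma_finite : sigma_finite setT leb_step.
Proof.
have [F FT mF] : sigma_finite setT (l \x m)%E by exact: prod_sigma_finite.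
exists (fun i => @tuncons n @^-1` F i).
  by rewrite -preimage_bigcup -FT preimage_setT.
move=> i; have [mFi Fi] := mF i; split.
  by rewrite -[X in measurable X]setTI; exact: measurable_tuncons.
rewrite /leb_step /pushforward -comp_preimage.
by rewrite (_ : _ @^-1` _ = F i)//; apply/seteqP; split => x /=; rewrite tconsK.
Qed.

HB.instance Definition _ := Measure_isSigmaFinite.Build _ _ _ leb_step
  leb_step_sigma_finite.

End Step.

(* Lebesgue measure on [R^n] as an iterated product of the one on [R]; the Dirac
   mass on the one-point space [R^0]. *)
Fixpoint lebesgue_tuple (n : nat) :
    {sigma_finite_measure set (n.-tuple mR) -> \bar R} :=
  match n with
  | 0 => \d_([tuple] : 0.-tuple mR)
  | n'.+1 => leb_step (@lebesgue_measure R) (lebesgue_tuple n')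
  end.

End Lebesgue.

Section Fourier.
Variables (R : realType) (d : nat).
Local Notation E := 'rV[R]_d.

Definition integral_rV (f : E -> R) : R :=
  \int[@lebesgue_tuple R d]_t f (\row_i tnth t i).

Definition cintegral_rV (f : E -> R[i]) : R[i] :=
  integral_rV (fun x => complex.Re (f x))
    +i* integral_rV (fun x => complex.Im (f x)).

(* e^{- i x . xi}; the transform is not normalized. *)
Definition fourier_char (xi x : E) : R[i] :=
  cos (dotp x xi) -i* sin (dotp x xi).

Definition fourier (f : E -> R[i]) : E -> R[i] :=
  fun xi => cintegral_rV (fun x => f x * fourier_char xi x).

End Fourier.

Section Microlocal.
Variables (R : realType) (d : nat).
Local Notation E := 'rV[R]_d.
Local Notation hE := (hyper R E).
Local Notation hfun := (hyper R (E -> R[i])).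

Definition hnorm (x : hE) : hyper R R := hmap (@enorm R d) x.
Definition hsub (x y : hE) : hE := hmap2 (fun a b => a - b) x y.
Definition hscale (t : hyper R R) (x : hE) : hE := hmap2 (fun a b => a *: b) t x.
Definition hdir (x : hE) : hE := hmap (fun a => (enorm a)^-1 *: a) x.

Definition cone (G : set hE) : Prop :=
  forall (t : hyper R R) (x : hE), hlt (hcst R 0) t -> G x -> G (hscale t x).

Definition fast_scale : set hE :=
  [set x | exists2 a : R, 0 < a & hle (rho_pow (- a)) (hnorm x)].

Definition fast_near (x y : hE) : Prop :=
  exists2 a : R, 0 < a & hle (hnorm (hsub x y)) (rho_pow a).

Definition hcompactly (Omega : set E) : set hE :=
  [set x | exists K : set E,
     [/\ compact K, K !=set0, K `<=` Omega & hstar K x]].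

Definition Mfun (A : set hE) (u : hfun) : Prop :=
  hpred (@csmooth R d) u /\
  forall (alpha : 'I_d -> nat) (x : hE), A x ->
    hmoderate (happ (hmap (cmderive alpha) u) x).

Definition compactly_supported_in (A : set hE) (u : hfun) : Prop :=
  exists K : hyper R (set E),
    [/\ hpred (fun k => compact k /\ k !=set0) K, hset K `<=` A &
        forall x : hE,
          (forall a, hset K a -> hlt (hcst R 0) (hnorm (hsub x a))) ->
          happ u x = hcst R 0].

Definition Mcfun (A : set hE) (u : hfun) : Prop :=
  Mfun setT u /\ compactly_supported_in A u.

Definition hfourier (u : hfun) : hfun := hmap (@fourier R d) u.

Definition microlocally_regular (Omega : set E) (u : hfun) (x0 xi0 : hE) :
    Prop :=
  exists v : hfun,
    [/\ Mcfun (hcompactly Omega) v,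
        forall x, fast_near x x0 -> happ u x = happ v x &
        forall xi, fast_scale xi -> fast_near (hdir xi) xi0 ->
          hnegligible (happ (hfourier v) xi)].

Definition rho_root (m : hyper R nat) : hyper R R :=
  hmap2 (fun r n => r `^ (n%:R^-1)) (rho R) m.

Definition cutoff (phi0 : E -> R) (m : hyper R nat) (x0 : hE) :
    hyper R (E -> R) :=
  hmap2 (fun r a => fun x => phi0 (r^-1 *: (x - a))) (rho_root m) x0.

Definition hmulf (g : hyper R (E -> R)) (u : hfun) : hfun :=
  hmap2 (fun g f => fun x => (g x)%:C * f x) g u.

End Microlocal.

(* Main.v *)
Require Import Defs.
From HB Require Import structures.
From mathcomp Require Import all_boot all_order all_algebra.
From mathcomp Require Import complex ring lra.
From mathcomp Require Import all_classical all_reals all_analysis.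

(* Fix first a finite m and a germ of points (x, xi) with x in V, xi in Gamma and
   |xi| >= rho^(-2/m). Microlocal regularity at (x, xi/|xi|) replaces u near x by a
   compactly supported v with F(v) negligible in all directions close to xi. To pass
   to the product with the cutoff g of radius s = rho^(1/m), approximate g uniformly by
   a trigonometric polynomial P, a multidimensional Fejer sum over a grid whose mesh is
   a large power of rho. Then F(P v)(xi) is a combination of values F(v)(xi - eta):
   for small frequencies eta they are negligible, and for large eta the coefficients of
   P are, by repeated summation by parts against the smooth function g. As germs can be
   chosen index by index, |F(g u)(xi)| <= rho^m holds uniformly in (x, xi) for small
   epsilon, and letting m grow slowly enough with epsilon gives the infinite k. *)

Set Implicit Arguments.
Unset Strict Implicit.
Unset Printing Implicit Defensive.

Import Order.TTheory GRing.Theory Num.Theory.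
Import numFieldNormedType.Exports.

Local Open Scope classical_set_scope.
Local Open Scope ring_scope.

(** Writing F(g v) as a convolution of F(g) and F(v) would call for Fourier inversion and for decay
    of F(v) at infinity. With a finite sum P in place of g, linearity of the integral and sup bounds
    on boxes suffice, and summation by parts stands in for integration by parts. With 2 S^2 nodes
    per axis the approximation error is only of order 1/S. This is enough: the number of frequencies
    is a fixed power of S, which the negligible values of F(v) and the coefficient decay of
    arbitrary order outweigh. Positivity of the Fejer kernel turns the error into a mean distance.
    The exponent 2/m leaves room between |xi| and the inverse cutoff radius rho^(-1/m), beyond which
    the coefficients start to decay, so that the frequencies can be split strictly between the two.
    The moderateness exponent of v depends on the germ (x, xi), but the final bound rho^m does not,
    and only that bound is made uniform. *)

(** * Integrals of continuous functions supported in a box *)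

Section BoxIntegral.
Variables (R : realType) (d : nat).
Local Notation mR := (measurableTypeR R).
Local Notation E := 'rV[R]_d.

Definition tuple_box n (r : R) : set (n.-tuple mR) :=
  [set t | forall i, `|tnth t i| <= r].

Lemma measurable_tuple_box n (r : R) : measurable (@tuple_box n r).
Proof.
rewrite (_ : tuple_box _ =
    \bigcap_(i in [set: 'I_n]) ((fun t => tnth t i) @^-1` `[-r, r])).
  apply: fin_bigcap_measurable; first exact: finite_finset.
  move=> i _; rewrite -[X in measurable X]setTI.
  by apply: (measurable_tnth i) => //; exact: measurable_itv.
apply/seteqP; split=> t /= h i; first by move=> _ /=; rewrite in_itv/= -ler_norml.
by have := h i I; rewrite /= in_itv/= -ler_norml.
Qed.

Lemma lebesgue_tuple_box n (r : R) : 0 <= r ->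
  lebesgue_tuple R n (@tuple_box n r) = ((2 * r) ^+ n)%:E.
Proof.
move=> r0; elim: n => [|n IH].
  rewrite (_ : tuple_box r = setT) /= ?diracT//.
  by apply/seteqP; split=> // t _ [].
rewrite /= /leb_step /pushforward.
rewrite (_ : _ @^-1` _ = [set` `[-r, r]] `*` @tuple_box n r); last first.
  apply/seteqP; split=> -[x t] /=.
    move=> h; split; last by move=> i; have := h (lift ord0 i); rewrite tnthS.
    by have := h ord0; rewrite /= in_itv/= -ler_norml tnth0.
  rewrite in_itv/= -ler_norml => -[h1 h2] i.
  by case: (unliftP ord0 i) => [j ->|->]; rewrite ?tnthS ?tnth0//; exact: h2.
rewrite product_measure1E//; last exact: measurable_tuple_box.
rewrite [X in (_ * X)%E](_ : _ = ((2 * r) ^+ n)%:E); last exact: IH.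
rewrite [X in (X * _)%E](_ : _ = if r > - r then (r - - r)%:E else 0%E); last first.
  by apply: etrans (lebesgue_measure_itv `[-r, r]) _; rewrite /= lte_fin EFinB.
case: ifPn => h; first by rewrite -EFinM exprS; congr (_%:E); ring.
have -> : r = 0 by lra.
by rewrite mul0e mulr0 expr0n.
Qed.

Definition stepR (k : nat) (x : R) : R := (Num.floor (k.+1%:R * x))%:~R / k.+1%:R.

Lemma stepRP k x : stepR k x <= x < stepR k x + k.+1%:R^-1.
Proof.
have k0 : 0 < k.+1%:R :> R by rewrite ltr0n.
rewrite /stepR; have /andP[h1 h2] := floor_itv (k.+1%:R * x).
rewrite intrD in h2.
rewrite ler_pdivrMr// -{2}(mul1r k.+1%:R^-1) -mulrDl ltr_pdivlMr// (mulrC x).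
by apply/andP.
Qed.

Lemma cvg_stepR x : stepR k x @[k --> \oo] --> x.
Proof.
apply/cvgrPdist_lt => e e0.
have := @cvg_harmonic R; move/cvgrPdist_lt => /(_ _ e0).
apply: filterS => k; rewrite sub0r normrN /= ger0_norm; last first.
  by rewrite invr_ge0 ler0n.
move=> ke; have := stepRP k x => /andP[h1 h2].
rewrite ger0_norm; last lra.
by apply: lt_trans ke; rewrite ltrBlDl.
Qed.

Lemma rV_norm_lt (x : E) (e : R) : 0 < e -> (forall i, `|x 0 i| < e) -> `|x| < e.
Proof.
move=> e0 h; rewrite /Num.norm /=; have [->//|/mx_norm_neq0[[i j] ->]] :=
  eqVneq (mx_norm x) 0.
by rewrite ord1; exact: h.
Qed.

Lemma cvg_step_rV (x : E) : (\row_i stepR k (x 0 i)) @[k --> \oo] --> x.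
Proof.
apply/cvgrPdist_lt => e e0.
have : \forall k \near \oo, forall i : 'I_d, `|x 0 i - stepR k (x 0 i)| < e.
  apply: filter_forall => i.
  have /cvgrPdist_lt := @cvg_stepR (x 0 i); exact.
apply: filterS => k h; apply: rV_norm_lt => // i; rewrite !mxE; exact: h.
Qed.

Lemma measurable_floor_fiber (a : R) (z : int) : 0 < a ->
  measurable ([set x | Num.floor (a * x) = z] : set mR).
Proof.
move=> a0.
rewrite (_ : [set x | _] = [set` `[z%:~R / a, (z + 1)%:~R / a[]); first exact: measurable_itv.
apply/seteqP; split=> x /=; rewrite in_itv/= ler_pdivrMr// ltr_pdivlMr// mulrC.
  by move=> <-; rewrite floor_itv.
by move=> h; apply: floor_def.
Qed.

(** True for every [f]: the rounded point takes countably many values, and each value is taken on a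
    measurable box. *)
Lemma measurable_step_rV (f : E -> R) k :
  measurable_fun setT (fun t : d.-tuple mR => f (\row_i stepR k (tnth t i))).
Proof.
move=> _ Y _; rewrite setTI.
pose pt (z : {ffun 'I_d -> int}) : E := \row_i ((z i)%:~R / k.+1%:R).
rewrite (_ : _ @^-1` _ = \bigcup_(z : {ffun 'I_d -> int})
   ([set t | Y (f (pt z))] `&` \bigcap_(i in [set: 'I_d])
     ((fun t => tnth t i) @^-1` [set x | Num.floor (k.+1%:R * x) = z i]))).
  apply: countable_bigcupT_measurable; first exact: countableP.
  move=> z; apply: measurableI.
    case: (pselect (Y (f (pt z)))) => h.
      by rewrite (_ : [set _ | _] = setT)//; apply/seteqP; split.
    by rewrite (_ : [set _ | _] = set0)//; apply/seteqP; split.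
  apply: fin_bigcap_measurable; first exact: finite_finset.
  move=> i _; rewrite -[X in measurable X]setTI.
  apply: (measurable_tnth i) => //; apply: measurable_floor_fiber.
  by rewrite ltr0n.
apply/seteqP; split=> t /=.
  move=> h; exists [ffun i => Num.floor (k.+1%:R * tnth t i)] => //; split => /=.
    rewrite (_ : pt _ = \row_i stepR k (tnth t i))//.
    by apply/rowP => i; rewrite !mxE ffunE.
  by move=> i _ /=; rewrite ffunE.
move=> [z _ [/= h1 h2]]; rewrite (_ : \row_i _ = pt z)//.
by apply/rowP => i; rewrite !mxE /stepR (h2 i I).
Qed.

(* No Borel structure is needed on ['rV_d]: a continuous function is a pointwise
   limit of functions of the integer parts of the scaled coordinates. *)
Lemma measurable_continuous_rV (f : E -> R) : continuous f ->
  measurable_fun setT (fun t : d.-tuple mR => f (\row_i tnth t i)).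
Proof.
move=> cf.
apply: (@measurable_realfun.measurable_fun_cvg _ _ _ _
  (fun k (t : d.-tuple mR) => f (\row_i stepR k (tnth t i)))).
  by move=> k; exact: measurable_step_rV.
move=> t _; set x : E := \row_i tnth t i.
have -> : (fun k => f (\row_i stepR k (tnth t i))) =
          (fun k => f (\row_i stepR k (x 0 i))).
  by apply/funext => k; congr f; apply/rowP => i; rewrite !mxE.
apply: (@cvg_comp _ _ _ (fun k => \row_i stepR k (x 0 i)) f _ (nbhs x)).
  exact: cvg_step_rV.
exact: cf.
Qed.

Definition in_box (r : R) (x : E) : Prop := forall i, `|x 0 i| <= r.

(** Continuity gives measurability; the box and the bound give integrability with an explicit
    estimate. *)
Definition box_fun (r M : R) (f : E -> R) : Prop :=
  [/\ continuous f, forall x, ~ in_box r x -> f x = 0 & forall x, `|f x| <= M].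

Lemma box_fun_integrable (r M : R) f : 0 <= r -> box_fun r M f ->
  (lebesgue_tuple R d).-integrable setT
    (EFin \o (fun t : d.-tuple mR => f (\row_i tnth t i))).
Proof.
move=> r0 [cf sf bf]; set g := fun t => _.
have mB := @measurable_tuple_box d r.
have gE : g = (fun t => g t * \1_(@tuple_box d r) t).
  apply/funext => t; rewrite indicE; case: (boolP (t \in _)) => h; rewrite ?mulr1//.
  rewrite mulr0 /g sf// => h'; move/negP: h; apply; apply/mem_set => i.
  by have := h' i; rewrite mxE.
rewrite gE.
have -> : EFin \o (fun t => g t * \1_(@tuple_box d r) t) =
   ((EFin \o g) \_ (@tuple_box d r)).
  apply/funext => t /=; rewrite patchE indicE; case: ifP; rewrite ?mulr1 ?mulr0//.
rewrite -integrable_mkcond//.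
apply: measurable_bounded_integrable => //.
- rewrite [X in (X < _)%E](_ : _ = ((2 * r) ^+ d)%:E) ?ltry//.
  exact: lebesgue_tuple_box.
- exact: measurable_funS (measurable_continuous_rV cf).
- exists M; split; first by rewrite num_real.
  by move=> m Mm t _; exact: le_trans (bf _) (ltW Mm).
Qed.

Lemma integral_rV_le (r M : R) f : 0 <= r -> box_fun r M f ->
  `|integral_rV f| <= M * (2 * r) ^+ d.
Proof.
move=> r0 bf; have [cf sf bM] := bf.
have mB := @measurable_tuple_box d r.
have M0 : 0 <= M by apply: le_trans (bM 0).
rewrite /integral_rV; apply: le_trans (le_normr_Rintegral _ (box_fun_integrable r0 bf)) _ => //.
rewrite /Rintegral -lee_fin fineK; last first.
  apply: integral_fune_fin_num => //.
  have := integrable_abse (box_fun_integrable r0 bf).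
  by apply: eq_integrable => // t _.
have <- : (\int[lebesgue_tuple R d]_t (M * \1_(@tuple_box d r) t)%:E = (M * (2 * r) ^+ d)%:E)%E.
  under eq_integral do rewrite EFinM.
  rewrite ge0_integralZl//.
  - rewrite integral_indic// setIT EFinM; congr (_ * _)%E.
    exact: lebesgue_tuple_box.
  - by apply/measurable_realfun.measurable_EFinP; exact: measurable_realfun.measurable_indic.
apply: ge0_le_integral => //.
- apply/measurable_realfun.measurable_EFinP/measurableT_comp => //; exact: measurable_continuous_rV.
- apply/measurable_realfun.measurable_EFinP/measurable_realfun.measurable_funM => //; exact: measurable_realfun.measurable_indic.
- move=> t _; rewrite lee_fin indicE; case: (boolP (t \in _)) => h; rewrite ?mulr1//.
  rewrite mulr0 sf ?normr0// => h'; move/negP: h; apply; apply/mem_set => i.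
  by have := h' i; rewrite mxE.
Qed.

Lemma integral_rVD (r M1 M2 : R) f g : 0 <= r -> box_fun r M1 f -> box_fun r M2 g ->
  integral_rV (fun x => f x + g x) = integral_rV f + integral_rV g.
Proof.
by move=> r0 hf hg; apply: RintegralD => //;
  [exact: box_fun_integrable hf|exact: box_fun_integrable hg].
Qed.

Lemma integral_rVZ (r M a : R) f : 0 <= r -> box_fun r M f ->
  integral_rV (fun x => a * f x) = a * integral_rV f.
Proof. by move=> r0 hf; apply: RintegralZl => //; exact: box_fun_integrable hf. Qed.

End BoxIntegral.

Local Notation normc := (@Normc.normc _).

(** * Elementary bounds for exp(i t), and the Fejer kernel *)

Section TrigKernel.
Local Open Scope complex_scope.
Variable R : realType.
Implicit Types (t x : R) (z w : R[i]).

Lemma normcE z : (normc z)%:C = `|z|.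
Proof. by []. Qed.

Lemma normc_ge0 z : 0 <= normc z.
Proof. by rewrite -lecR normcE normr_ge0. Qed.

Lemma normcD z w : normc (z + w) <= normc z + normc w.
Proof. by rewrite -lecR rmorphD /= !normcE ler_normD. Qed.

Lemma normc_sum (I : Type) (r : seq I) (P : pred I) (f : I -> R[i]) :
  normc (\sum_(i <- r | P i) f i) <= \sum_(i <- r | P i) normc (f i).
Proof. by rewrite -lecR rmorph_sum /= normcE ler_norm_sum. Qed.

Lemma normc_real x : normc x%:C = `|x|.
Proof. by rewrite /= expr0n addr0 sqrtr_sqr. Qed.

Lemma normc_leReIm z : normc z <= `|complex.Re z| + `|complex.Im z|.
Proof.
case: z => a b; rewrite /= -[leRHS]ger0_norm ?addr_ge0// -sqrtr_sqr.
by apply: ler_wsqrtr; rewrite sqrrD !real_normK ?num_real// lerD2r lerDl mulrn_wge0// mulr_ge0.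
Qed.

Lemma Re_le_normc z : `|complex.Re z| <= normc z.
Proof. by case: z => a b; rewrite /= -sqrtr_sqr ler_wsqrtr// lerDl sqr_ge0. Qed.

Lemma Im_le_normc z : `|complex.Im z| <= normc z.
Proof. by case: z => a b; rewrite /= -sqrtr_sqr ler_wsqrtr// lerDr sqr_ge0. Qed.

Definition cis (t : R) : R[i] := cos t +i* sin t.
Arguments cis : simpl never.

Lemma cis0 : cis 0 = 1.
Proof. by rewrite /cis cos0 sin0. Qed.

Lemma cisD t x : cis (t + x) = cis t * cis x.
Proof. by rewrite /cis cosD sinD; simpc; congr (_ +i* _); rewrite addrC. Qed.

Lemma normc_cis t : normc (cis t) = 1.
Proof. by rewrite /= cos2Dsin2 sqrtr1. Qed.

Lemma cis_neq0 t : cis t != 0.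
Proof. by apply/eqP => h; have := normc_cis t; rewrite h Normc.normc0 => /eqP; rewrite eq_sym oner_eq0. Qed.

Lemma cisN t : cis (- t) = (cis t)^*.
Proof. by rewrite /cis cosN sinN. Qed.

Lemma cisNV t : cis (- t) = (cis t)^-1.
Proof.
apply: (mulfI (cis_neq0 t)); rewrite -cisD subrr cis0 mulfV//; exact: cis_neq0.
Qed.

Lemma cisX t n : cis (n%:R * t) = cis t ^+ n.
Proof.
elim: n => [|n IH]; first by rewrite mul0r cis0 expr0.
by rewrite -natr1 mulrDl mul1r cisD IH exprSr.
Qed.

Lemma cis_sum (I : Type) (r : seq I) (P : pred I) (f : I -> R) :
  cis (\sum_(i <- r | P i) f i) = \prod_(i <- r | P i) cis (f i).
Proof. exact: (big_morph _ cisD cis0). Qed.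

Lemma cis_2pi : cis (pi *+ 2) = 1.
Proof. by rewrite /cis cos2pi sin2pi. Qed.

Lemma cis_2pin n : cis (n%:R * (pi *+ 2)) = 1.
Proof. by rewrite cisX cis_2pi expr1n. Qed.

(** Comparison of derivatives: it turns [cos y <= 1] into [sin_le], and [cos_ge] into [sin_ge]. *)
Lemma nonneg_of_derive (f df : R -> R) x : 0 <= x -> f 0 = 0 ->
  (forall y : R, is_derive y (1 : R) f (df y)) -> (forall y, 0 <= y -> 0 <= df y) -> 0 <= f x.
Proof.
move=> x0 f0 hd dfp.
have [c cI] : exists2 c : R, c \in `[0, x] & f x - f 0 = df c * (x - 0).
  apply: MVT_segment => //; apply: derivable_within_continuous => y _.
  exact: (@ex_derive _ _ _ _ _ _ _ (hd y)).
rewrite f0 !subr0 => ->; apply: mulr_ge0 => //; apply: dfp.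
by move: cI; rewrite in_itv => /andP[].
Qed.

Lemma sin_le x : 0 <= x -> sin x <= x.
Proof.
move=> x0; rewrite -subr_ge0.
apply: (@nonneg_of_derive (fun y => y - sin y) (fun y => 1 - cos y)) => //.
  by rewrite sin0 subr0.
Qed.

Lemma cos_ge x : 0 <= x -> 1 - x ^+ 2 / 2 <= cos x.
Proof.
move=> x0; have [y y0 ->] : exists2 y, 0 <= y & x = y *+ 2.
  by exists (x / 2); [lra|rewrite (mulr2n (x / 2)) -splitr].
rewrite cos_mulr2n; have := cos2sin2 y.
have h1 := sin_le y0.
have : sin y ^+ 2 <= y ^+ 2.
  (* [sin_le] controls the square only for a nonnegative sine; a negative one forces [2 <= y], and
     there the square of the sine is at most 1. *)
  have [s0|s0] := leP 0 (sin y); first by rewrite ler_sqr ?nnegrE.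
  have sN1 := sin_geN1 y.
  have [yy|yy] := leP 2 y.
    have : sin y ^+ 2 <= 1 by nra.
    have : 4 <= y ^+ 2 by nra.
    by lra.
  have [->|yn] := eqVneq y 0; first by rewrite sin0.
  have : 0 < y < 2 by rewrite yy lt_neqAle eq_sym yn y0.
  by move/sin2_gt0 => /lt_trans /(_ s0); rewrite ltxx.
rewrite -(mulr_natr y) -(mulr_natr (cos y ^+ 2)); nra.
Qed.

Lemma sin_ge x : 0 <= x -> x - x ^+ 3 / 6 <= sin x.
Proof.
move=> x0; rewrite -subr_ge0.
apply: (@nonneg_of_derive (fun y => sin y - (y - y ^+ 3 / 6))
  (fun y => cos y - (1 - y ^+ 2 / 2))) => //.
- by rewrite sin0 expr0n/= mul0r !subr0.
- by move=> y; apply: is_derive_eq; rewrite /GRing.scale /=; field.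
- by move=> y y0; rewrite subr_ge0 cos_ge.
Qed.

(** At pi, [sin_ge] says pi^2 >= 6. The value 12/5 ensures pi / 2 - 1 / 5 >= 1, as [le_sin] needs
    after reflection at pi / 2. *)
Lemma pi_ge : 12 / 5 <= pi :> R.
Proof.
have := sin_ge (pi_ge0 R); rewrite sinpi => h.
rewrite leNgt; apply/negP => h2; have := @pi_ge2 R => h3.
nra.
Qed.

Lemma pi_le4 : pi <= 4 :> R.
Proof. by have := @pihalf_lt2 R; lra. Qed.

(** Up to 1 the cubic Taylor bound suffices; beyond, monotonicity and reflection give sin x >= sin 1
    >= 5/6, which exceeds x / 4 on this range. *)
Lemma le_sin x : 0 <= x <= pi / 2 + 1 / 5 -> x / 4 <= sin x.
Proof.
move=> /andP[x0 xp]; have := pi_ge; have := pi_le4 => p4 pg.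
have s1 : 5 / 6 <= sin 1 :> R by have := @sin_ge 1 ler01; rewrite !expr1n; lra.
have [x1|x1] := leP x 1.
  by apply: le_trans (sin_ge x0); nra.
suff : sin 1 <= sin x by lra.
have mono (a : R) : 1 <= a <= pi / 2 -> sin 1 <= sin a.
  move=> /andP[a1 a2]; have [->//|an] := eqVneq a 1.
  apply: ltW; rewrite ltr_sin ?in_itv/= ?lt_neqAle 1?eq_sym ?an//; apply/andP; split; lra.
have [x2|x2] := leP x (pi / 2); first by apply: mono; rewrite (ltW x1).
have -> : sin x = sin (pi - x) by rewrite sinB sinpi cospi; ring.
by apply: mono; apply/andP; split; lra.
Qed.

Lemma normc_cisB1 t : normc (cis t - 1) = 2 * `|sin (t / 2)|.
Proof.
have -> : 2 * `|sin (t / 2)| = `|2 * sin (t / 2)| by rewrite normrM ger0_norm.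
rewrite -sqrtr_sqr /=; congr Num.sqrt.
have e : t = (t / 2) *+ 2 by rewrite (mulr2n (t / 2)) -splitr.
rewrite {1 2}e cos_mulr2n sin_mulr2n; have := cos2sin2 (t / 2).
move: (cos _) (sin _) => c s; rewrite !mulr2n oppr0 addr0 => h.
have -> : c ^+ 2 + c ^+ 2 - 1 - 1 = - (2 * s ^+ 2) by rewrite h; ring.
have -> : (c * s + c * s) ^+ 2 = 4 * c ^+ 2 * s ^+ 2 by ring.
by rewrite h; ring.
Qed.

(** The margin 2/5 beyond pi admits the difference of a point of [-1/4, 1/4] and a node in
    [-pi, pi], as in [sum_dist_fejer]; at 2 pi the bound would fail. *)
Lemma le_normc_cisB1 t : `|t| <= pi + 2 / 5 -> `|t| <= 4 * normc (cis t - 1).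
Proof.
move=> h; rewrite normc_cisB1.
have -> : `|sin (t / 2)| = `|sin (`|t| / 2)|.
  have [t0|t0] := lerP 0 t; [by rewrite (ger0_norm t0)|rewrite (ltr0_norm t0)].
  by rewrite mulNr sinN normrN.
have := @le_sin (`|t| / 2); have t0 := normr_ge0 t.
have -> : 0 <= `|t| / 2 <= pi / 2 + 1 / 5 by apply/andP; split; lra.
move=> /(_ isT) h2; have := ler_norm (sin (`|t| / 2)); lra.
Qed.

Section Fejer.
Variable N : nat.
Hypothesis N0 : (0 < N)%N.

(* The Fejer kernel sampled at 2N equidistant nodes; its frequencies lie strictly
   between -N and N, so that sampling is exact. *)
Definition fejer (t : R) : R :=
  (2 * N%:R ^+ 2)^-1 * normc (\sum_(p < N) cis (p%:R * t)) ^+ 2.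

Definition node (y : nat) : R := pi * y%:R / N%:R - pi.

Lemma fejer_ge0 t : 0 <= fejer t.
Proof. by rewrite mulr_ge0 ?invr_ge0 ?mulr_ge0 ?exprn_ge0 ?normc_ge0. Qed.

Lemma fejerE t : (fejer t)%:C = ((2 * N%:R ^+ 2)^-1)%:C *
  \sum_(w : 'I_N * 'I_N) cis ((w.1%:R - w.2%:R) * t).
Proof.
rewrite /fejer rmorphM rmorphXn /= normcE sqr_normc; congr (_ * _).
rewrite rmorph_sum big_distrlr /= pair_bigA /=; apply: eq_bigr => w _.
have -> : (w.1%:R - w.2%:R) * t = w.1%:R * t + - (w.2%:R * t) by ring.
by rewrite cisD cisN.
Qed.

Let NR0 : 0 < N%:R :> R. Proof. by rewrite ltr0n. Qed.

Lemma node_itv y : (y <= N.*2)%N -> - pi <= node y <= pi.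
Proof.
move=> yN; rewrite /node; have p0 := pi_gt0 R.
have : 0 <= pi * y%:R / N%:R :> R by rewrite !mulr_ge0 ?invr_ge0 ?pi_ge0 ?ler0n.
have : pi * y%:R / N%:R <= pi * 2 :> R.
  by rewrite ler_pdivrMr// -mulrA ler_pM2l// -natrM ler_nat mul2n.
by move=> h1 h2; apply/andP; split; lra.
Qed.

(** Discrete orthogonality: for [p != q] the sum is geometric with a ratio [w] such that
    [w ^+ N.*2 = 1], and [w] differs from 1 because 0 < |p - q| < N. *)
Lemma sum_cis_node t (p q : 'I_N) :
  \sum_(y < N.*2) cis ((p%:R - q%:R) * (t - node y)) = ((p == q) * N.*2)%:R.
Proof.
have [->|pq] := eqVneq p q.
  rewrite mul1n; under eq_bigr do rewrite subrr mul0r cis0.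
  by rewrite sumr_const card_ord.
rewrite mul0n; pose k : R := p%:R - q%:R; pose w := cis (- (k * (pi / N%:R))).
have p0 := pi_gt0 R.
have wM : w ^+ N.*2 = 1.
  rewrite -cisX (_ : _ * _ = q%:R * (pi *+ 2) - p%:R * (pi *+ 2)); last first.
    by rewrite /k -mul2n natrM !mulr2n; field; rewrite lt0r_neq0.
  by rewrite cisD cisNV !cis_2pin invr1 mulr1.
have w1 : w - 1 != 0.
  apply/eqP => h; have := @le_normc_cisB1 (- (k * (pi / N%:R))).
  rewrite -/w h Normc.normc0 mulr0 normrN normrM.
  have kN : `|k| <= N%:R.
    have := ltn_ord p; have := ltn_ord q.
    rewrite -(ltr_nat R) => h1; rewrite -(ltr_nat R) => h2.
    have := ler0n R p; have := ler0n R q.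
    by rewrite ler_norml /k => *; apply/andP; split; lra.
  have pN : 0 < pi / N%:R :> R by rewrite divr_gt0.
  rewrite (ger0_norm (ltW pN)).
  have h1 : `|k| * (pi / N%:R) <= pi + 2 / 5.
    apply: (@le_trans _ _ (N%:R * (pi / N%:R))); first by rewrite ler_pM2r.
    by rewrite mulrC divfK ?gt_eqF// lerDl; lra.
  move=> /(_ h1); rewrite pmulr_lle0// normr_le0 subr_eq0 eqr_nat => /eqP/val_inj/eqP.
  by rewrite (negbTE pq).
have E y : cis (k * (t - node y)) = cis (k * (t + pi)) * w ^+ y.
  by rewrite -cisX -cisD /node; congr cis; ring.
under eq_bigr do rewrite E.
rewrite -mulr_sumr; have : (w - 1) * \sum_(y < N.*2) w ^+ y = 0.
  by rewrite -subrX1 wM subrr.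
by move/eqP; rewrite mulf_eq0 (negbTE w1) /= => /eqP ->; rewrite mulr0.
Qed.

(** Only the N diagonal pairs survive, each with weight 2 N; hence the normalization 1 / (2 N^2) of
    [fejer]. *)
Lemma sum_fejer t : \sum_(y < N.*2) fejer (t - node y) = 1.
Proof.
apply: (@complexI R); rewrite rmorph_sum /=.
under eq_bigr do rewrite fejerE.
rewrite -mulr_sumr exchange_big /=.
under eq_bigr do rewrite sum_cis_node.
rewrite -(pair_bigA _ (fun p q : 'I_N => ((p == q) * N.*2)%:R)) /=.
have E (p : 'I_N) : \sum_(q < N) ((p == q) * N.*2)%:R = (N.*2)%:R :> R[i].
  rewrite (bigD1 p)//= eqxx mul1n big1 ?addr0// => q qp.
  by rewrite eq_sym (negbTE qp).
under eq_bigr do rewrite E.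
rewrite sumr_const card_ord -mulrnA -mul2n -(rmorph_nat (real_complex R)) -rmorphM /=.
congr (_%:C); rewrite !natrM; field; exact: lt0r_neq0.
Qed.

(** The factor cis t - 1 telescopes the geometric sum to cis (N t) - 1, of modulus at most 2. This
    expresses the concentration of the kernel near 0. *)
Lemma fejer_dist t : normc (cis t - 1) ^+ 2 * fejer t <= 2 / N%:R ^+ 2.
Proof.
rewrite /fejer mulrCA -exprMn -Normc.normcM.
have -> : (cis t - 1) * (\sum_(p < N) cis (p%:R * t)) = cis t ^+ N - 1.
  by rewrite subrX1; congr (_ * _); apply: eq_bigr => p _; rewrite cisX.
have h : normc (cis t ^+ N - 1) <= 2.
  apply: le_trans (normcD _ _) _.
  by rewrite -cisX normc_cis normcN Normc.normc1; lra.
have -> : 2 / N%:R ^+ 2 = (2 * N%:R ^+ 2)^-1 * 2 ^+ 2 :> R.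
  by field; exact: lt0r_neq0.
rewrite ler_pM2l ?invr_gt0 ?mulr_gt0 ?exprn_gt0//.
by rewrite ler_sqr ?nnegrE ?normc_ge0.
Qed.

End Fejer.

(** After splitting each term, the total mass 1 contributes 2 / S and the 2 N nodes contribute 8 S /
    N in all; N = S^2 balances the two. *)
Lemma sum_dist_fejer S t : (0 < S)%N -> `|t| <= 1 / 4 ->
  \sum_(y < (S ^ 2).*2) `|t - node (S ^ 2) y| * fejer (S ^ 2) (t - node (S ^ 2) y) <= 10 / S%:R.
Proof.
move=> S0 t4; set N := (S ^ 2)%N; have N0 : (0 < N)%N by rewrite expn_gt0 S0.
have SR : 0 < S%:R :> R by rewrite ltr0n.
have NE : N%:R = S%:R ^+ 2 :> R by rewrite natrX.
(* AM-GM: [2 c <= 1 / S + S c^2] *)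
have E (y : 'I_(N.*2)) : `|t - node N y| * fejer N (t - node N y) <=
    2 / S%:R * fejer N (t - node N y) + 2 * S%:R * (2 / N%:R ^+ 2).
  set s := t - node N y; have f0 := fejer_ge0 N s.
  have h1 : `|s| <= pi + 2 / 5.
    have /andP[n1 n2] := node_itv N0 (ltnW (ltn_ord y)).
    move: t4; rewrite /s !ler_norml => /andP[t1 t2].
    by apply/andP; split; lra.
  have h2 := le_normc_cisB1 h1; have h3 := fejer_dist N0 s.
  have c0 := normc_ge0 (cis s - 1).
  set c := normc _ in h2 h3 c0 *.
  have h4 : 2 * c <= S%:R^-1 + S%:R * c ^+ 2.
    have h : 0 <= S%:R^-1 * (1 - S%:R * c) ^+ 2 by rewrite mulr_ge0 ?invr_ge0 ?sqr_ge0.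
    suff e : S%:R^-1 * (1 - S%:R * c) ^+ 2 = S%:R^-1 + S%:R * c ^+ 2 - 2 * c by lra.
    by field; exact: lt0r_neq0.
  have h5 : S%:R * (c ^+ 2 * fejer N s) <= S%:R * (2 / N%:R ^+ 2) by rewrite ler_pM2l.
  have h6 : `|s| * fejer N s <= 2 * (S%:R^-1 + S%:R * c ^+ 2) * fejer N s.
    by apply: ler_wpM2r => //; lra.
  apply: le_trans h6 _; rewrite mulrDr mulrDl lerD// -!mulrA; lra.
apply: le_trans (ler_sum _ (fun y _ => E y)) _.
rewrite big_split /= -mulr_sumr sum_fejer// sumr_const card_ord.
rewrite -[_ *+ N.*2]mulr_natr -mul2n (natrM _ 2 N) NE le_eqVlt; apply/orP; left.
by apply/eqP; field; exact: lt0r_neq0.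
Qed.

End TrigKernel.

(** * Finite differences and partial derivatives *)

Section FiniteDifferences.
Variables (R : realType) (d : nat).
Local Notation E := 'rV[R]_d.
Implicit Types (f g : E -> R) (i : 'I_d) (x y : E) (h C : R).
Local Notation e_ i := (delta_mx 0 i : E).

Lemma is_derive_line f i x h : derivable f (x + h *: e_ i) (e_ i) ->
  is_derive h (1 : R) (fun t => f (x + t *: e_ i)) (pderive i f (x + h *: e_ i)).
Proof.
move=> df.
have E1 : (fun k => k^-1 *: (f (k *: e_ i + (x + h *: e_ i)) - f (x + h *: e_ i))) =
  (fun k : R => k^-1 *: (f (x + (k *: (1 : R) + h) *: e_ i) - f (x + h *: e_ i))).
  apply/funext => k; congr (_ *: (f _ - _)).
  by rewrite (mulr1 k : k *: (1 : R) = k) scalerDl addrCA.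
split; first by rewrite /derivable /= -E1; exact: df.
by rewrite /pderive /derive /= -E1.
Qed.

Lemma mean_value_le f i x h C : (forall y, derivable f y (e_ i)) ->
  (forall y, `|pderive i f y| <= C) -> `|f (x + h *: e_ i) - f x| <= C * `|h|.
Proof.
move=> df bf; pose phi t := f (x + t *: e_ i).
have hd t : is_derive t (1 : R) phi (pderive i f (x + t *: e_ i)).
  exact: is_derive_line.
have cphi (a b : R) : {within `[a, b], continuous phi}.
  by apply: derivable_within_continuous => t _; exact: (@ex_derive _ _ _ _ _ _ _ (hd t)).
have -> : f (x + h *: e_ i) - f x = phi h - phi 0 by rewrite /phi scale0r addr0.
have [h0|h0] := leP 0 h.
  have [c _ ->] := MVT_segment h0 (fun t _ => hd t) (cphi 0 h).
  by rewrite subr0 normrM ler_wpM2r.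
rewrite distrC; have [c _ ->] := MVT_segment (ltW h0) (fun t _ => hd t) (cphi h 0).
by rewrite sub0r normrM normrN ler_wpM2r.
Qed.

Definition fdiff i h f : E -> R := fun x => f (x + h *: e_ i) - f x.

Lemma derivable_shift f i x h : derivable f (x + h *: e_ i) (e_ i) ->
  derivable (fun y => f (y + h *: e_ i)) x (e_ i) /\
  pderive i (fun y => f (y + h *: e_ i)) x = pderive i f (x + h *: e_ i).
Proof.
move=> df.
have E1 : (fun k => k^-1 *: (f (k *: e_ i + (x + h *: e_ i)) - f (x + h *: e_ i))) =
  (fun k : R => k^-1 *: (f (k *: e_ i + x + h *: e_ i) - f (x + h *: e_ i))).
  by apply/funext => k; rewrite addrA.
split; first by rewrite /derivable /= -E1; exact: df.
by rewrite /pderive /derive /= -E1.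
Qed.

Lemma derivable_fdiff f i h : (forall x, derivable f x (e_ i)) ->
  (forall x, derivable (fdiff i h f) x (e_ i)) /\
  pderive i (fdiff i h f) = fdiff i h (pderive i f).
Proof.
move=> df; split=> [x|].
  by apply: derivableB; [exact: (derivable_shift (df _)).1|exact: df].
apply/funext => x; have [d1 e1] := derivable_shift (df (x + h *: e_ i)).
by rewrite /fdiff -e1; exact: deriveB.
Qed.

(** Differences commute with derivatives, and the mean value theorem trades each difference for one
    derivative and a factor [h]. *)
Lemma iter_fdiff_le r f i h C : 0 <= h ->
  (forall k x, (k < r)%N -> derivable (iter k (pderive i) f) x (e_ i)) ->
  (forall x, `|iter r (pderive i) f x| <= C) ->
  forall x, `|iter r (fdiff i h) f x| <= C * h ^+ r.
Proof.
move=> h0; elim: r f C => [|r IH] f C df bf x.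
  by rewrite expr0 mulr1; exact: bf.
have E1 k : (k <= r)%N -> iter k (pderive i) (fdiff i h f) = fdiff i h (iter k (pderive i) f).
  elim: k => [//|k IHk] kr /=; rewrite IHk 1?ltnW//.
  by apply: (derivable_fdiff _ _).2 => y; apply: df; rewrite ltnS ltnW.
rewrite iterSr exprS mulrA; apply: IH => [k y kr|y].
  rewrite E1 1?ltnW//; apply: (derivable_fdiff _ _).1 => z; apply: df.
  by rewrite ltnS ltnW.
rewrite E1// /fdiff -{2}(ger0_norm h0); apply: mean_value_le => z.
  exact: df.
by rewrite -iterS.
Qed.

Definition rescale (s : R) (x0 : E) f : E -> R := fun x => f (s^-1 *: (x - x0)).

Lemma iter_fdiff_rescale r i h s x0 f :
  iter r (fdiff i h) (rescale s x0 f) = rescale s x0 (iter r (fdiff i (s^-1 * h)) f).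
Proof.
elim: r => [//|r IH]; rewrite !iterS IH; apply/funext => x.
by rewrite /fdiff /rescale -scalerA -scalerDr addrAC.
Qed.

(** Moving from [y] to [x] one coordinate at a time requires only partial derivatives. The l^1
    distance suits the product kernel, which is handled coordinatewise. *)
Lemma lipschitz_of_pderive f C : (forall i y, derivable f y (e_ i)) ->
  (forall i y, `|pderive i f y| <= C) ->
  forall x y, `|f x - f y| <= C * \sum_i `|x 0 i - y 0 i|.
Proof.
move=> df bf x y.
pose z (k : nat) : E := \row_j (if (j < k)%N then x 0 j else y 0 j).
have zd : z d = x by apply/rowP => j; rewrite mxE ltn_ord.
have z0 : z 0%N = y by apply/rowP => j; rewrite mxE.
rewrite -{1}zd -{1}z0 -(@telescope_sumr _ 0 d (fun k => f (z k)))// big_mkord.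
apply: le_trans (ler_norm_sum _ _ _) _; rewrite mulr_sumr; apply: ler_sum => i _.
have -> : z i.+1 = z i + (x 0 i - y 0 i) *: e_ i.
  apply/rowP => j; rewrite !mxE eqxx /= ltnS leq_eqVlt.
  have [->|ji] := eqVneq j i; first by rewrite eqxx /= ltnn mulr1 addrC subrK.
  by rewrite -val_eqE in ji; rewrite (negbTE ji) /= mulr0 addr0.
exact: mean_value_le.
Qed.

Lemma pderive_eq0 f i (K : set E) : closed K -> (forall x, ~ K x -> f x = 0) ->
  forall x, ~ K x -> pderive i f x = 0.
Proof.
move=> cK f0 x Kx; rewrite /pderive.
have h : \forall y \near x, f y = cst (0 : R) y.
  have oK : open (~` K) by exact: closed_openC.
  by have := open_nbhs_nbhs (conj oK Kx); apply: filterS => y /f0.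
by rewrite (near_eq_derive _ h) derive_cst.
Qed.

Lemma compact_support_bounded f (K : set E) : compact K -> continuous f ->
  (forall x, ~ K x -> f x = 0) -> exists2 C, 0 <= C & forall x, `|f x| <= C.
Proof.
move=> cK cf f0.
have := @compact_bounded _ _ _ (continuous_compact (continuous_subspaceT cf) cK).
move=> [M [_ hM]]; exists (`|M| + 1); first by rewrite addr_ge0.
move=> x; case: (pselect (K x)) => [Kx|/f0 ->]; last by rewrite normr0 addr_ge0.
apply: (hM (`|M| + 1)); last by exists x.
by rewrite (le_lt_trans (ler_norm M))// ltrDl.
Qed.

Lemma foldr_nseq i f r : foldr (@pderive R d) f (nseq r i) = iter r (pderive i) f.
Proof. by elim: r => //= r ->. Qed.

Lemma smooth_derivable f i r : smooth f ->
  forall x, derivable (iter r (pderive i) f) x (e_ i).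
Proof. by move=> sf x; have [_] := sf (nseq r i); rewrite foldr_nseq; exact. Qed.

Lemma smooth_continuous f i r : smooth f -> continuous (iter r (pderive i) f).
Proof. by move=> sf; have [] := sf (nseq r i); rewrite foldr_nseq. Qed.

Lemma iter_pderive_bounded f (K : set E) r : compact K -> smooth f ->
  (forall x, ~ K x -> f x = 0) ->
  exists2 C, 0 <= C & forall i x, `|iter r (pderive i) f x| <= C.
Proof.
move=> cK sf f0.
have H i : exists C, 0 <= C /\ forall x, `|iter r (pderive i) f x| <= C.
  have [] := @compact_support_bounded (iter r (pderive i) f) K cK.
  - exact: smooth_continuous.
  - elim: r => [//|r IH] /=; apply: pderive_eq0 => //.
    exact: compact_closed.
  - by move=> C C0 hC; exists C.
have [C hC] := choice H.
exists (\sum_i C i); first by apply: sumr_ge0 => i _; case: (hC i).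
move=> i x; apply: le_trans ((hC i).2 x) _.
by rewrite (bigD1 i)//= lerDl sumr_ge0// => j _; case: (hC j).
Qed.

End FiniteDifferences.

(** * Complex integrals and Fourier transforms of functions supported in a box *)

Section ComplexIntegral.
Local Open Scope complex_scope.
Variables (R : realType) (d : nat).
Local Notation E := 'rV[R]_d.
Implicit Types (f g v : E -> R[i]) (x xi eta : E).

Lemma continuous_addR (f g : E -> R) :
  continuous f -> continuous g -> continuous (fun x => f x + g x).
Proof. by move=> cf cg x; exact: (continuousD (cf x) (cg x)). Qed.

Lemma continuous_oppR (f : E -> R) : continuous f -> continuous (fun x => - f x).
Proof. by move=> cf x; exact: (continuousN (cf x)). Qed.

Lemma continuous_mulR (f g : E -> R) :
  continuous f -> continuous g -> continuous (fun x => f x * g x).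
Proof. by move=> cf cg x; exact: (continuousM (cf x) (cg x)). Qed.

Lemma continuous_sumR (I : Type) (s : seq I) (F : I -> E -> R) :
  (forall i, continuous (F i)) -> continuous (fun x => \sum_(i <- s) F i x).
Proof.
move=> cF; elim: s => [|i s IH].
  rewrite (_ : (fun x => _) = fun=> 0); first by exact: cst_continuous.
  by apply/funext => x; rewrite big_nil.
rewrite (_ : (fun x => _) = fun x => F i x + \sum_(j <- s) F j x).
  exact: continuous_addR.
by apply/funext => x; rewrite big_cons.
Qed.

Definition cbox (r M : R) f : Prop :=
  [/\ continuous (fun x => complex.Re (f x)), continuous (fun x => complex.Im (f x)),
      forall x, ~ in_box r x -> f x = 0 & forall x, normc (f x) <= M].

Lemma cbox_ge0 r M f : cbox r M f -> 0 <= M.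
Proof. by move=> [_ _ _ /(_ 0)]; apply: le_trans; exact: normc_ge0. Qed.

Lemma cbox_Re r M f : cbox r M f -> box_fun r M (fun x => complex.Re (f x)).
Proof.
move=> [c1 _ s b]; split=> // x; first by move/s ->.
exact: le_trans (Re_le_normc _) (b x).
Qed.

Lemma cbox_Im r M f : cbox r M f -> box_fun r M (fun x => complex.Im (f x)).
Proof.
move=> [_ c1 s b]; split=> // x; first by move/s ->.
exact: le_trans (Im_le_normc _) (b x).
Qed.

Lemma cbox_le r M1 M2 f : (forall x, normc (f x) <= M2) -> cbox r M1 f -> cbox r M2 f.
Proof. by move=> h []. Qed.

Lemma cboxD r M1 M2 f g : cbox r M1 f -> cbox r M2 g -> cbox r (M1 + M2) (fun x => f x + g x).
Proof.
move=> [f1 f2 f3 f4] [g1 g2 g3 g4]; split=> [| |x|x].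
- have -> : (fun x => complex.Re (f x + g x)) = (fun x => complex.Re (f x) + complex.Re (g x)).
    by apply/funext => y; case: (f y) (g y) => [? ?] [].
  exact: continuous_addR.
- have -> : (fun x => complex.Im (f x + g x)) = (fun x => complex.Im (f x) + complex.Im (g x)).
    by apply/funext => y; case: (f y) (g y) => [? ?] [].
  exact: continuous_addR.
- by move=> h; rewrite f3// g3// addr0.
- exact: le_trans (normcD _ _) (lerD (f4 x) (g4 x)).
Qed.

Lemma ReM (z w : R[i]) : complex.Re (z * w) =
  complex.Re z * complex.Re w - complex.Im z * complex.Im w.
Proof. by case: z w => [? ?] []. Qed.

Lemma ImM (z w : R[i]) : complex.Im (z * w) =
  complex.Re z * complex.Im w + complex.Im z * complex.Re w.
Proof. by case: z w => [? ?] []. Qed.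

Lemma cboxM r M1 M2 f g : continuous (fun x => complex.Re (g x)) ->
  continuous (fun x => complex.Im (g x)) -> (forall x, normc (g x) <= M2) ->
  cbox r M1 f -> cbox r (M1 * M2) (fun x => f x * g x).
Proof.
move=> g1 g2 g4 [f1 f2 f3 f4]; split=> [| |x|x].
- have -> : (fun x => complex.Re (f x * g x)) = (fun x => complex.Re (f x) * complex.Re (g x) - complex.Im (f x) * complex.Im (g x)).
    by apply/funext => y; exact: ReM.
  by apply: continuous_addR; [|apply: continuous_oppR]; exact: continuous_mulR.
- have -> : (fun x => complex.Im (f x * g x)) = (fun x => complex.Re (f x) * complex.Im (g x) + complex.Im (f x) * complex.Re (g x)).
    by apply/funext => y; exact: ImM.
  by apply: continuous_addR; exact: continuous_mulR.
- by move=> h; rewrite f3// mul0r.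
- by rewrite Normc.normcM ler_pM ?normc_ge0.
Qed.

Lemma cboxZ r M (c : R[i]) f : cbox r M f -> cbox r (M * normc c) (fun x => c * f x).
Proof.
move=> h; have -> : (fun x => c * f x) = (fun x => f x * c) by apply/funext=> x; rewrite mulrC.
by apply: cboxM  => //; exact: cst_continuous.
Qed.

Lemma cbox_sum r (I : Type) (M : I -> R) (s : seq I) (F : I -> E -> R[i]) :
  (forall i, cbox r (M i) (F i)) ->
  cbox r (\sum_(i <- s) M i) (fun x => \sum_(i <- s) F i x).
Proof.
move=> h; elim: s => [|i s IH].
  rewrite big_nil (_ : (fun x => _) = fun=> 0); last first.
    by apply/funext => x; rewrite big_nil.
  by split=> [| |//|x]; [exact: cst_continuous|exact: cst_continuous|rewrite Normc.normc0].
rewrite big_cons (_ : (fun x => _) = fun x => F i x + \sum_(j <- s) F j x).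
  exact: cboxD.
by apply/funext => x; rewrite big_cons.
Qed.

Section Linear.
Variable r : R.
Hypothesis r0 : 0 <= r.

Lemma normc_cintegral_le M f : cbox r M f ->
  normc (cintegral_rV f) <= 2 * M * (2 * r) ^+ d.
Proof.
move=> h; apply: le_trans (normc_leReIm _) _ => /=.
have := integral_rV_le r0 (cbox_Re h); have := integral_rV_le r0 (cbox_Im h).
by set a := `|_|; set b := `|_|; lra.
Qed.

Lemma cintegralD M1 M2 f g : cbox r M1 f -> cbox r M2 g ->
  cintegral_rV (fun x => f x + g x) = cintegral_rV f + cintegral_rV g.
Proof.
move=> hf hg; rewrite /cintegral_rV; simpc; congr (_ +i* _).
  rewrite -(integral_rVD r0 (cbox_Re hf) (cbox_Re hg)); congr integral_rV.
  by apply/funext => x; case: (f x) (g x) => [? ?] [].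
rewrite -(integral_rVD r0 (cbox_Im hf) (cbox_Im hg)); congr integral_rV.
by apply/funext => x; case: (f x) (g x) => [? ?] [].
Qed.

Lemma box_funZ M (a : R) (f : E -> R) : box_fun r M f ->
  box_fun r (`|a| * M) (fun x => a * f x).
Proof.
move=> [f1 f2 f3]; split=> [|x h|x].
- by apply: continuous_mulR  => //; exact: cst_continuous.
- by rewrite f2// mulr0.
- by rewrite normrM ler_wpM2l.
Qed.

Lemma cintegralZ M (c : R[i]) f : cbox r M f ->
  cintegral_rV (fun x => c * f x) = c * cintegral_rV f.
Proof.
move=> h; have hR := cbox_Re h; have hI := cbox_Im h.
case: c => a b; rewrite /cintegral_rV; simpc; congr (_ +i* _).
  rewrite -(integral_rVZ a r0 hR) -mulNr -(integral_rVZ (- b) r0 hI).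
  rewrite -(integral_rVD r0 (box_funZ a hR) (box_funZ (- b) hI)).
  by congr integral_rV; apply/funext => x; rewrite ReM /= mulNr.
rewrite -(integral_rVZ a r0 hI) -(integral_rVZ b r0 hR).
rewrite -(integral_rVD r0 (box_funZ a hI) (box_funZ b hR)).
by congr integral_rV; apply/funext => x; rewrite ImM.
Qed.

Lemma cintegral_sum (I : Type) (M : I -> R) (s : seq I) (F : I -> E -> R[i]) :
  (forall i, cbox r (M i) (F i)) ->
  cintegral_rV (fun x => \sum_(i <- s) F i x) = \sum_(i <- s) cintegral_rV (F i).
Proof.
move=> h; elim: s => [|i s IH].
  have c0 : cbox r 0 (fun=> 0 : R[i]).
    by split=> [| |//|x]; [exact: cst_continuous|exact: cst_continuous|rewrite Normc.normc0].
  rewrite big_nil (_ : (fun x => _) = fun x => 0 * (fun=> 0 : R[i]) x).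
    by rewrite (cintegralZ _ c0) mul0r.
  by apply/funext => x; rewrite big_nil mul0r.
rewrite big_cons -IH -(cintegralD (h i) (cbox_sum s h)); congr cintegral_rV.
by apply/funext => x; rewrite big_cons.
Qed.

End Linear.

Lemma continuous_dotp xi : continuous (fun x => dotp x xi).
Proof.
apply: continuous_sumR => i; apply: continuous_mulR  ; last exact: cst_continuous.
exact: coord_continuous.
Qed.

Lemma fourier_charE xi x : fourier_char xi x = cis (- dotp x xi).
Proof. by rewrite cisN. Qed.

Lemma dotpB x xi eta : dotp x (xi - eta) = dotp x xi - dotp x eta.
Proof. by rewrite /dotp -sumrB; apply: eq_bigr => i _; rewrite !mxE mulrBr. Qed.

Lemma fourier_charB xi eta x :
  fourier_char (xi - eta) x = cis (dotp x eta) * fourier_char xi x.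
Proof. by rewrite !fourier_charE -cisD dotpB; congr cis; ring. Qed.

Lemma cbox_fourier_char r M f xi : cbox r M f ->
  cbox r M (fun x => f x * fourier_char xi x).
Proof.
move=> h; rewrite -(mulr1 M); apply: cboxM h => [x||x].
- by apply: (continuous_comp (@continuous_dotp xi x)); exact: continuous_cos.
- apply: continuous_oppR => x.
  by apply: (continuous_comp (@continuous_dotp xi x)); exact: continuous_sin.
- by rewrite fourier_charE normc_cis.
Qed.

Lemma normc_fourier_le r M f xi : 0 <= r -> cbox r M f ->
  normc (fourier f xi) <= 2 * M * (2 * r) ^+ d.
Proof. by move=> r0 h; apply: normc_cintegral_le => //; exact: cbox_fourier_char. Qed.

(* Multiplying by a trigonometric polynomial [P] averages the transform over shifts
   by the frequencies of [P]. *)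
Lemma normc_fourier_trig (W : finType) (c : W -> R[i]) (eta : W -> E) (g : E -> R)
    v (r M D : R) xi : 0 <= r -> cbox r M v -> continuous g -> (forall x, `|g x| <= 1) ->
  (forall x, in_box r x ->
     normc ((g x)%:C - \sum_w c w * cis (dotp x (eta w))) <= D) ->
  normc (fourier (fun x => (g x)%:C * v x) xi) <=
    \sum_w normc (c w) * normc (fourier v (xi - eta w)) + 2 * (D * M) * (2 * r) ^+ d.
Proof.
move=> r0 hv cg g1 hD.
pose F w x := c w * (v x * fourier_char (xi - eta w) x).
have hF w : cbox r (M * normc (c w)) (F w) by apply: cboxZ; exact: cbox_fourier_char.
pose G x := v x * (g x)%:C * fourier_char xi x.
have hG : cbox r M G.
  apply: cbox_fourier_char; rewrite -(mulr1 M); apply: cboxM hv => [||x].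
  - exact: cg.
  - exact: cst_continuous.
  - by rewrite normc_real.
have hS := cbox_sum (index_enum W) hF.
have hH := cboxD hG (cboxZ (-1) hS).
set H := fun x => _ in hH.
have -> : fourier (fun x => (g x)%:C * v x) xi =
    \sum_w c w * fourier v (xi - eta w) + cintegral_rV H.
  have -> : \sum_w c w * fourier v (xi - eta w) = cintegral_rV (fun x => \sum_w F w x).
    rewrite (cintegral_sum r0 _ hF); apply: eq_bigr => w _.
    by rewrite -(cintegralZ r0 _ (cbox_fourier_char _ hv)).
  rewrite -(cintegralD r0 hS hH) /fourier; congr cintegral_rV.
  by apply/funext => x; rewrite /H /G; ring.
(* The bound supplied by [cboxD] is too coarse; regrouped, [H] is [v] times the approximation error,
   up to a character of modulus 1. *)
have hH' : cbox r (D * M) H.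
  apply: cbox_le hH => x.
  have -> : H x = v x * ((g x)%:C - \sum_w c w * cis (dotp x (eta w))) * fourier_char xi x.
    rewrite /H /G mulN1r mulrBr mulrBl; congr (_ - _).
    rewrite mulr_sumr mulr_suml; apply: eq_bigr => w _.
    by rewrite /F fourier_charB; ring.
  rewrite fourier_charE !Normc.normcM normc_cis mulr1.
  have [_ _ hv3 hv4] := hv.
  case: (pselect (in_box r x)) => [hx|/hv3 ->].
    by rewrite mulrC ler_pM ?normc_ge0//; exact: hD.
  rewrite Normc.normc0 mul0r mulr_ge0 ?(cbox_ge0 hv)//.
  (* The origin lies in the box, so [D] bounds a modulus and is nonnegative. *)
  apply: le_trans (normc_ge0 _) (hD 0 _) => i; by rewrite mxE normr0.
apply: le_trans (normcD _ _) _; apply: lerD; last exact: normc_cintegral_le.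
apply: le_trans (normc_sum _ _ _) _; apply: ler_sum => w _.
by rewrite Normc.normcM.
Qed.

End ComplexIntegral.

(** * Trigonometric approximation on a grid, and decay of its coefficients *)

Section GridApproximation.
Local Open Scope complex_scope.
Variables (R : realType) (d N : nat) (L : R).
Hypotheses (N0 : (0 < N)%N) (L0 : 0 < L).
Local Notation E := 'rV[R]_d.
Local Notation Y := {ffun 'I_d -> 'I_(N.*2)}.
Local Notation W := {ffun 'I_d -> 'I_N * 'I_N}.
Implicit Types (X : E) (y : Y) (w : W) (g : E -> R) (i : 'I_d).

Let NR0 : 0 < N%:R :> R. Proof. by rewrite ltr0n. Qed.

Definition grid_pt y : E := \row_j (L * node R N (y j)).
(** Frequencies are indexed by pairs and not by their differences: the triangular Fejer weights then
    become multiplicities, all terms having the same prefactor. *)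
Definition grid_diff w i : R := (w i).1%:R - (w i).2%:R.
Definition grid_freq w : E := \row_j (grid_diff w j / L).
Definition grid_kernel y X : R := \prod_j fejer N (X 0 j / L - node R N (y j)).
Definition grid_sum g w : R[i] :=
  \sum_y (g (grid_pt y))%:C * cis (- dotp (grid_pt y) (grid_freq w)).
Definition grid_coef g w : R[i] := ((2 * N%:R ^+ 2)^-1 ^+ d)%:C * grid_sum g w.

Lemma grid_dotp y w : dotp (grid_pt y) (grid_freq w) = \sum_j node R N (y j) * grid_diff w j.
Proof.
by apply: eq_bigr => j _; rewrite !mxE; field; exact: lt0r_neq0.
Qed.

Lemma grid_kernel_ge0 y X : 0 <= grid_kernel y X.
Proof. by apply: prodr_ge0 => j _; exact: fejer_ge0. Qed.

(** Expanding every Fejer factor turns the kernel average of [g] into a trigonometric polynomial in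
    [X], with discrete Fourier sums of [g] as coefficients. *)
Lemma grid_approxE g X :
  (\sum_y g (grid_pt y) * grid_kernel y X)%:C =
  \sum_w grid_coef g w * cis (dotp X (grid_freq w)).
Proof.
have KE y : (grid_kernel y X)%:C = ((2 * N%:R ^+ 2)^-1 ^+ d)%:C *
    \sum_w cis (- dotp (grid_pt y) (grid_freq w)) * cis (dotp X (grid_freq w)).
  rewrite /grid_kernel rmorph_prod /=; under eq_bigr do rewrite fejerE//.
  rewrite big_split /= prodr_const card_ord -rmorphXn /=; congr (_ * _).
  rewrite bigA_distr_bigA /=; apply: eq_bigr => w _.
  rewrite -cis_sum -cisD grid_dotp /dotp -sumrN -big_split /=; congr cis.
  by apply: eq_bigr => j _; rewrite !mxE /grid_diff; field; exact: lt0r_neq0.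
rewrite rmorph_sum /=; under eq_bigr do rewrite rmorphM /= KE.
rewrite /grid_coef /grid_sum; under [RHS]eq_bigr do rewrite mulrAC mulr_sumr.
rewrite exchange_big /=; apply: eq_bigr => y _.
by rewrite mulrCA !mulr_sumr; apply: eq_bigr => w _; ring.
Qed.

(* Under the product kernel the coordinates are independent. *)
Lemma sum_grid_kernel_coord (h : 'I_(N.*2) -> R) i X :
  \sum_(y : Y) h (y i) * grid_kernel y X = \sum_z h z * fejer N (X 0 i / L - node R N z).
Proof.
pose F j (z : 'I_(N.*2)) := (if j == i then h z else 1) * fejer N (X 0 j / L - node R N z).
have FE y : h (y i) * grid_kernel y X = \prod_j F j (y j).
  rewrite /F big_split /=; congr (_ * _); rewrite (bigD1 i)//= eqxx big1 ?mulr1//.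
  by move=> j /negbTE ->.
under eq_bigr do rewrite FE.
rewrite -(bigA_distr_bigA F) (bigD1 i)//= [X in _ * X]big1 ?mulr1.
  by apply: eq_bigr => z _; rewrite /F eqxx.
move=> j /negbTE ji; rewrite /F ji.
by under eq_bigr do rewrite mul1r; rewrite sum_fejer.
Qed.

Lemma sum_grid_kernel X : \sum_(y : Y) grid_kernel y X = 1.
Proof.
rewrite /grid_kernel -(bigA_distr_bigA (fun j (z : 'I_(N.*2)) => fejer N (X 0 j / L - node R N z))).
by rewrite big1// => j _; rewrite sum_fejer.
Qed.

Lemma card_grid : #|{: Y}| = ((2 * N) ^ d)%N.
Proof. by rewrite card_ffun !card_ord mul2n. Qed.

(** The (2 N)^d terms against the prefactor (2 N^2)^-d leave N^-d, which is at most 1. *)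
Lemma normc_grid_coef_le g w C : (forall x, `|g x| <= C) -> normc (grid_coef g w) <= C.
Proof.
move=> gC; have C0 : 0 <= C by exact: le_trans (gC 0).
rewrite /grid_coef Normc.normcM normc_real ger0_norm; last first.
  by rewrite exprn_ge0// invr_ge0 mulr_ge0// sqr_ge0.
have hs : normc (grid_sum g w) <= ((2 * N%:R) ^+ d) * C.
  apply: le_trans (normc_sum _ _ _) _.
  apply: (@le_trans _ _ (\sum_(y : Y) C)).
    by apply: ler_sum => y _; rewrite Normc.normcM normc_cis mulr1 normc_real.
  by rewrite sumr_const card_grid -[leLHS]mulr_natl natrX natrM.
apply: (@le_trans _ _ ((2 * N%:R ^+ 2)^-1 ^+ d * ((2 * N%:R) ^+ d * C))).
  by rewrite ler_wpM2l// exprn_ge0// invr_ge0 mulr_ge0// sqr_ge0.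
rewrite mulrA -exprMn (_ : (2 * N%:R ^+ 2)^-1 * (2 * N%:R) = N%:R^-1); last by field; exact: lt0r_neq0.
rewrite ler_piMl// exprn_ile1 ?invr_ge0 ?ler0n// invf_le1 ?ltr0n// ler1n//.
Qed.

Section SummationByParts.
Variables (w : W) (i : 'I_d).

Let step : R := L * (pi / N%:R).

(** Cyclic, so that it permutes the grid and reindexing produces no boundary terms. *)
Definition grid_next y : Y := [ffun j => if j == i then ordS (y j) else y j].

Lemma grid_next_bij : bijective grid_next.
Proof.
exists (fun y : Y => [ffun j => if j == i then ord_pred (y j) else y j] : Y) => y;
  apply/ffunP => j; rewrite !ffunE; case: eqP => // _; rewrite ?ordSK ?ord_predK//.
Qed.

(** Shifting the grid by one step multiplies the character by a fixed phase, so reindexing moves the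
    difference from [g] to the character. *)
Lemma grid_sum_fdiff1 g (A : R) : A <= L * pi - step ->
  (forall x : E, A <= `|x 0 i| -> g x = 0) ->
  grid_sum (fdiff i step g) w = (cis (grid_diff w i * (pi / N%:R)) - 1) * grid_sum g w.
Proof.
move=> Api g0; rewrite mulrBl mul1r.
have p0 := pi_gt0 R; have pN : 0 < pi / N%:R :> R by rewrite divr_gt0.
have ALpi : A <= L * pi by apply: le_trans Api _; rewrite gerBl mulr_ge0 ?ltW.
have shift y : g (grid_pt y + step *: delta_mx 0 i) = g (grid_pt (grid_next y)) /\
   cis (- dotp (grid_pt y) (grid_freq w)) =
   cis (grid_diff w i * (pi / N%:R)) * cis (- dotp (grid_pt (grid_next y)) (grid_freq w)).
  have De (z : Y) : \sum_j node R N (z j) * grid_diff w j =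
      node R N (z i) * grid_diff w i + \sum_(j | j != i) node R N (z j) * grid_diff w j.
    by rewrite (bigD1 i).
  have nE : grid_next y i = ordS (y i) by rewrite ffunE eqxx.
  rewrite !grid_dotp !De nE.
  have -> : \sum_(j | j != i) node R N (grid_next y j) * grid_diff w j =
     \sum_(j | j != i) node R N (y j) * grid_diff w j.
    by apply: eq_bigr => j /negbTE ji; rewrite ffunE ji.
  set rest := \sum_(_ | _) _.
  (* At the last node the shifted point has coordinate L pi and its cyclic successor -L pi: [g]
     vanishes at both, and the phases differ by a multiple of 2 pi. *)
  have := ltn_ord (y i); rewrite leq_eqVlt => /orP[/eqP yM|yM].
    have nx0 : ordS (y i) = 0%N :> nat by rewrite /= yM modnn.
    have nx0' : ((y i).+1 %% N.*2 = 0)%N by [].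
    have y1 : (y i)%:R = 2 * N%:R - 1 :> R.
      have e : (y i).+1%:R = (N.*2)%:R :> R by congr (_%:R).
      by rewrite -natrM mul2n -e -natr1 addrK.
    split.
      rewrite !g0// !mxE ?ffunE !eqxx /=.
        rewrite /node nx0' mulr0 mul0r sub0r mulrN normrN ger0_norm// mulr_ge0//; exact: ltW.
      rewrite /node y1 mulr1.
      have -> : L * (pi * (2 * N%:R - 1) / N%:R - pi) + step = L * pi.
        by rewrite /step; field; exact: lt0r_neq0.
      by rewrite ger0_norm// mulr_ge0// ltW.
    rewrite /node nx0 y1 -cisD.
    set a := - (_ + rest); set b := (X in _ = cis X).
    have -> : b = a + ((w i).1%:R * (pi *+ 2) - (w i).2%:R * (pi *+ 2)).
      rewrite /a /b /grid_diff -[pi *+ 2]mulr_natr; field; exact: lt0r_neq0.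
    by rewrite !cisD cisNV !cis_2pin invr1 !mulr1.
  have nx : ordS (y i) = (y i).+1 :> nat by rewrite /= modn_small.
  split.
    congr g; apply/rowP => j; rewrite !mxE eqxx /= ffunE.
    have [->|ji] := eqVneq j i; last by rewrite mulr0 addr0.
    by rewrite /node nx -natr1 /step mulr1; field; exact: lt0r_neq0.
  rewrite -cisD /node nx -natr1; congr cis.
  by field; exact: lt0r_neq0.
rewrite /grid_sum /fdiff.
under eq_bigr do rewrite rmorphB mulrBl /=.
rewrite sumrB; congr (_ - _).
rewrite [in RHS](reindex grid_next) /=; last exact/onW_bij/grid_next_bij.
rewrite mulr_sumr; apply: eq_bigr => y _; have [-> ->] := shift y.
by rewrite mulrCA.
Qed.

(** Every difference widens the support by one step in direction [i]; the margin keeps it away from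
    the ends of the grid. *)
Lemma grid_sum_fdiff r g (A : R) : A + r%:R * step <= L * pi ->
  (forall x : E, A <= `|x 0 i| -> g x = 0) ->
  grid_sum (iter r (fdiff i step) g) w =
  (cis (grid_diff w i * (pi / N%:R)) - 1) ^+ r * grid_sum g w.
Proof.
have s0 : 0 <= step by rewrite !mulr_ge0 ?invr_ge0 ?pi_ge0// ltW.
elim: r g A => [|r IH] g A hA g0; first by rewrite expr0 mul1r.
rewrite iterSr exprSr -mulrA -(@grid_sum_fdiff1 g A)//.
  rewrite (IH _ (A + step))//; first by move: hA; rewrite -natr1; lra.
  move=> x hx; rewrite /fdiff !g0 ?subrr//; first by lra.
  rewrite !mxE !eqxx mulr1.
  have := ler_normD (x 0 i + step) (- step); rewrite addrK normrN (ger0_norm s0).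
  by lra.
move: hA; rewrite -natr1; have : 0 <= r%:R * step by rewrite mulr_ge0.
lra.
Qed.

(** After [r] summations by parts the factor |cis - 1|^r is at least (|frequency| step / 4)^r, and
    step^r cancels. As pi >= 2, [2 * r <= N] keeps the widened support inside the grid. *)
Lemma grid_coef_decay r g (C : R) : (2 * r <= N)%N ->
  (forall x : E, L / 4 <= `|x 0 i| -> g x = 0) ->
  (forall x, `|iter r (fdiff i step) g x| <= C * step ^+ r) ->
  normc (grid_coef g w) * `|grid_freq w 0 i| ^+ r <= C * 4 ^+ r.
Proof.
move=> rN g0 gC.
have p0 := pi_gt0 R; have pN : 0 < pi / N%:R :> R by rewrite divr_gt0.
have p2 := @pi_ge2 R.
have st0 : 0 < step by rewrite mulr_gt0.
set c := cis (grid_diff w i * (pi / N%:R)) - 1.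
have hA : L / 4 + r%:R * step <= L * pi.
  have -> : r%:R * step = L * pi * (r%:R / N%:R).
    by rewrite /step; field; exact: lt0r_neq0.
  have rN' : r%:R / N%:R <= 1 / 2 :> R.
    by rewrite ler_pdivrMr// mulrC mulrA mulr1 ler_pdivlMr// mulrC -natrM ler_nat.
  have : L * pi * (r%:R / N%:R) <= L * pi * (1 / 2).
    by rewrite ler_pM2l// mulr_gt0.
  have : L * 2 <= L * pi by rewrite ler_pM2l.
  move: (_ / N%:R) (L * pi) => a b h1 h2; have L0' := L0; lra.
have h1 := grid_sum_fdiff hA g0; rewrite -/c in h1.
have h2 : normc (grid_coef g w) * normc c ^+ r <= C * step ^+ r.
  have -> : normc (grid_coef g w) * normc c ^+ r =
      normc (grid_coef (iter r (fdiff i step) g) w).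
    rewrite /grid_coef h1 !Normc.normcM.
    have -> : normc (c ^+ r) = normc c ^+ r.
      by elim: {+}r => [|k IH]; rewrite ?expr0 ?Normc.normc1// !exprS Normc.normcM IH.
    by ring.
  exact: normc_grid_coef_le.
have kN : `|grid_diff w i| <= N%:R.
  have := ltn_ord (w i).1; have := ltn_ord (w i).2.
  rewrite -(ltr_nat R) => q1; rewrite -(ltr_nat R) => q2.
  have := ler0n R (w i).1; have := ler0n R (w i).2.
  by rewrite ler_norml /grid_diff => *; apply/andP; split; lra.
have h3 : `|grid_freq w 0 i| * step <= 4 * normc c.
  have -> : `|grid_freq w 0 i| * step = `|grid_diff w i * (pi / N%:R)|.
    rewrite mxE !normrM normfV (gtr0_norm L0) (gtr0_norm p0) normfV (gtr0_norm NR0) /step.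
    by field; rewrite !lt0r_neq0.
  apply: le_normc_cisB1; rewrite normrM (gtr0_norm pN).
  apply: (@le_trans _ _ (N%:R * (pi / N%:R))); first by rewrite ler_pM2r.
  by rewrite mulrC divfK ?gt_eqF// lerDl; lra.
have sr0 : 0 < step ^+ r by rewrite exprn_gt0.
rewrite -(ler_pM2r sr0) -mulrA -exprMn.
apply: (@le_trans _ _ (normc (grid_coef g w) * (4 * normc c) ^+ r)).
  rewrite ler_wpM2l ?normc_ge0// lerXn2r ?nnegrE ?mulr_ge0 ?normc_ge0//; exact: ltW.
by rewrite exprMn mulrCA mulrAC [leRHS]mulrC ler_wpM2l// exprn_ge0.
Qed.

End SummationByParts.

End GridApproximation.

(** * Uniform error of the grid approximation *)

Section GridError.
Local Open Scope complex_scope.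
Variables (R : realType) (d S : nat) (L K : R) (g : 'rV[R]_d -> R).
Hypotheses (S0 : (0 < S)%N) (L0 : 0 < L) (K0 : 0 <= K).
Hypothesis gK : forall x y, `|g x - g y| <= K * \sum_i `|x 0 i - y 0 i|.

(** Since the kernel has total mass 1, the error is at most the mean of |g X - g y|; the Lipschitz
    bound reduces it to [d] one-dimensional mean distances. *)
Lemma grid_approx_err X : in_box (L / 4) X ->
  normc ((g X)%:C - \sum_(w : {ffun 'I_d -> 'I_(S ^ 2) * 'I_(S ^ 2)}) grid_coef L g w * cis (dotp X (grid_freq L w))) <=
  K * (L * d%:R * (10 / S%:R)).
Proof.
move=> hX; set N := (S ^ 2)%N; have N0 : (0 < N)%N by rewrite expn_gt0 S0.
rewrite -grid_approxE// -rmorphB normc_real.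
have -> : g X = \sum_(y : {ffun 'I_d -> 'I_(N.*2)}) g X * grid_kernel L y X.
  by rewrite -mulr_sumr sum_grid_kernel// mulr1.
rewrite -sumrB; apply: le_trans (ler_norm_sum _ _ _) _.
have E (y : {ffun 'I_d -> 'I_(N.*2)}) :
  `|g X * grid_kernel L y X - g (grid_pt L y) * grid_kernel L y X| <=
   K * \sum_i (L * `|X 0 i / L - node R N (y i)|) * grid_kernel L y X.
  rewrite -mulrBl normrM (ger0_norm (grid_kernel_ge0 _ _ _)).
  apply: le_trans (ler_wpM2r (grid_kernel_ge0 _ _ _) (gK _ _)) _.
  rewrite -mulrA mulr_suml ler_wpM2l// ler_sum// => i _.
  rewrite mxE le_eqVlt; apply/orP; left; apply/eqP; congr (_ * _).
  rewrite -{2}(gtr0_norm L0) -normrM; congr `|_|; field; exact: lt0r_neq0.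
apply: le_trans (ler_sum _ (fun y _ => E y)) _.
rewrite -mulr_sumr ler_wpM2l// exchange_big /=.
rewrite -mulrA mulrC -mulrA -[X in _ <= _ * X]mulr1.
apply: (@le_trans _ _ (\sum_(i < d) L * (10 / S%:R))).
  apply: ler_sum => i _.
  rewrite (sum_grid_kernel_coord L N0 (fun z => L * `|X 0 i / L - node R N z|)).
  under eq_bigr do rewrite -mulrA.
  rewrite -mulr_sumr ler_pM2l//; apply: sum_dist_fejer => //.
  by rewrite normrM normfV (gtr0_norm L0) ler_pdivrMr// mulrC mulrA mulr1; exact: hX.
rewrite sumr_const card_ord -[leLHS]mulr_natl; lra.
Qed.

End GridError.

(** * Euclidean norm and directions *)

Section EuclideanNorm.
Variables (R : realType) (d : nat).
Local Notation E := 'rV[R]_d.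
Implicit Types (x y : E).

Lemma dotp_ge0 x : 0 <= dotp x x.
Proof. by apply: sumr_ge0 => i _; rewrite -expr2 sqr_ge0. Qed.

Lemma enorm_ge0 x : 0 <= enorm x.
Proof. exact: sqrtr_ge0. Qed.

Lemma sqr_enorm x : enorm x ^+ 2 = dotp x x.
Proof. by rewrite sqr_sqrtr// dotp_ge0. Qed.

Lemma coord_le_enorm x i : `|x 0 i| <= enorm x.
Proof.
rewrite -sqrtr_sqr /enorm ler_wsqrtr// /dotp (bigD1 i)//= expr2 lerDl.
by apply: sumr_ge0 => j _; rewrite -expr2 sqr_ge0.
Qed.

Lemma enormZ (a : R) x : enorm (a *: x) = `|a| * enorm x.
Proof.
rewrite /enorm -sqrtr_sqr -sqrtrM ?sqr_ge0//; congr Num.sqrt.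
by rewrite /dotp mulr_sumr; apply: eq_bigr => i _; rewrite !mxE; ring.
Qed.

Lemma enormN x : enorm (- x) = enorm x.
Proof. by rewrite -scaleN1r enormZ normrN normr1 mul1r. Qed.

Lemma enorm_eq0 x : enorm x = 0 -> x = 0.
Proof.
move=> x0; apply/rowP => i; rewrite mxE; apply/eqP.
by rewrite -normr_le0 -x0 coord_le_enorm.
Qed.

(** Cauchy-Schwarz, from expanding the square of |y| x - |x| y. *)
Lemma dotp_le x y : dotp x y <= enorm x * enorm y.
Proof.
have [y0|y0] := eqVneq (enorm y) 0.
  rewrite y0 mulr0 (enorm_eq0 y0) /dotp big1// => i _; by rewrite mxE mulr0.
have yp : 0 < enorm y by rewrite lt_neqAle eq_sym y0 enorm_ge0.
have [x0|x0] := eqVneq (enorm x) 0.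
  rewrite x0 mul0r (enorm_eq0 x0) /dotp big1// => i _; by rewrite mxE mul0r.
have xp : 0 < enorm x by rewrite lt_neqAle eq_sym x0 enorm_ge0.
have : 0 <= dotp (enorm y *: x - enorm x *: y) (enorm y *: x - enorm x *: y).
  exact: dotp_ge0.
have -> : dotp (enorm y *: x - enorm x *: y) (enorm y *: x - enorm x *: y) =
   enorm y ^+ 2 * dotp x x + enorm x ^+ 2 * dotp y y - 2 * enorm x * enorm y * dotp x y.
  rewrite /dotp !mulr_sumr -big_split -sumrB; apply: eq_bigr => i _.
  by rewrite !mxE /=; ring.
rewrite -!sqr_enorm => h.
have : 0 <= (enorm x * enorm y) * (enorm x * enorm y - dotp x y) by lra.
by rewrite pmulr_rge0 ?mulr_gt0// subr_ge0.
Qed.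

Lemma enormD x y : enorm (x + y) <= enorm x + enorm y.
Proof.
rewrite -ler_sqr ?nnegrE ?addr_ge0 ?enorm_ge0// sqr_enorm.
have -> : dotp (x + y) (x + y) = dotp x x + dotp y y + 2 * dotp x y.
  rewrite /dotp mulr_sumr -!big_split; apply: eq_bigr => i _.
  by rewrite !mxE /=; ring.
by rewrite -!sqr_enorm; have := dotp_le x y; lra.
Qed.

Lemma enorm_le_box (r : R) x : 0 <= r -> in_box r x -> enorm x <= d%:R * r.
Proof.
move=> r0 h; rewrite -ler_sqr ?nnegrE ?mulr_ge0 ?enorm_ge0// sqr_enorm.
apply: (@le_trans _ _ (\sum_(i < d) r ^+ 2)).
  apply: ler_sum => i _; rewrite -expr2 -(real_normK (num_real (x 0 i))).
  by rewrite ler_sqr ?nnegrE.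
rewrite sumr_const card_ord -[leLHS]mulr_natl exprMn ler_wpM2r ?sqr_ge0//.
by rewrite -natrX ler_nat; case: (d) => // n; rewrite leq_pmulr.
Qed.

Lemma enorm_dirB x y : x != 0 -> x - y != 0 ->
  enorm ((enorm (x - y))^-1 *: (x - y) - (enorm x)^-1 *: x) <= 2 * enorm y / enorm x.
Proof.
move=> x0 xy0.
have xp : 0 < enorm x.
  by rewrite lt_neqAle enorm_ge0 andbT eq_sym; apply: contra_neq x0; exact: enorm_eq0.
have xyp : 0 < enorm (x - y).
  by rewrite lt_neqAle enorm_ge0 andbT eq_sym; apply: contra_neq xy0; exact: enorm_eq0.
(* One part accounts for the change of length, the other for the shift by [y]; each has norm at most
   |y| / |x|. *)
have -> : (enorm (x - y))^-1 *: (x - y) - (enorm x)^-1 *: x =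
   ((enorm x - enorm (x - y)) / (enorm x * enorm (x - y))) *: (x - y) + (- (enorm x)^-1) *: y.
  apply/rowP => i; rewrite !mxE; field; by rewrite !lt0r_neq0.
apply: le_trans (enormD _ _) _; rewrite !enormZ normrN normfV normrM normfV normrM.
rewrite (gtr0_norm xp) (gtr0_norm xyp).
have h : `|enorm x - enorm (x - y)| <= enorm y.
  rewrite ler_norml; have := enormD (x - y) y; rewrite subrK.
  have := enormD x (- y); rewrite enormN => *; apply/andP; split; lra.
have -> : `|enorm x - enorm (x - y)| / (enorm x * enorm (x - y)) * enorm (x - y) =
  `|enorm x - enorm (x - y)| / enorm x by field; rewrite !lt0r_neq0.
rewrite (mulrC _^-1) -mulrDl ler_pM2r ?invr_gt0//; lra.
Qed.

End EuclideanNorm.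

(** * The estimate with all parameters explicit *)

Section LocalEstimate.
Local Open Scope complex_scope.
Variables (R : realType) (d : nat) (phi0 : 'rV[R]_d -> R).
Hypotheses (phi0_smooth : smooth phi0) (phi0_le1 : forall x, `|phi0 x| <= 1).
Hypothesis phi0_supp : forall (x : 'rV[R]_d) i, 1 <= `|x 0 i| -> phi0 x = 0.
Variables (C1 Cq : R) (q : nat).
Hypothesis C1P : forall i x, `|pderive i phi0 x| <= C1.
Hypothesis CqP : forall i x, `|iter q (pderive i) phi0 x| <= Cq.
Variables (S : nat) (L s r Lam M W : R) (x0 xi : 'rV[R]_d) (v : 'rV[R]_d -> R[i]).
Hypotheses (S0 : (0 < S)%N) (qS : (2 * q <= S ^ 2)%N) (s0 : 0 < s) (r0 : 0 <= r).
Hypotheses (rL : r + s <= L / 4) (x0r : in_box r x0) (vM : cbox r M v) (Lam0 : 0 < Lam).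
Hypothesis vW : forall eta, in_box Lam eta -> normc (fourier v (xi - eta)) <= W.
Hypotheses (C10 : 0 <= C1) (Cq0 : 0 <= Cq).

(** The frequencies are split at [Lam]. In that box, coefficients are at most 1 and [vW] applies;
    outside, some coordinate exceeds [Lam], and decay of order [q] is paired with the trivial bound
    on the transform of [v]. There are (S^2)^(2 d) index pairs; the last term is the approximation
    error. *)
Lemma local_estimate :
  normc (fourier (fun x => (rescale s x0 phi0 x)%:C * v x) xi) <=
  S%:R ^+ (4 * d) * (W + Cq * (4 / (s * Lam)) ^+ q * (2 * M * (2 * r) ^+ d))
  + 2 * (C1 / s * (L * d%:R * (10 / S%:R)) * M) * (2 * r) ^+ d.
Proof.
set g := rescale s x0 phi0.
have L0 : 0 < L by move: s0 r0 rL => *; lra.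
have M0 := cbox_ge0 vM.
have N0 : (0 < S ^ 2)%N by rewrite expn_gt0 S0.
have dphi i y : derivable phi0 y (delta_mx 0 i) := @smooth_derivable R d phi0 i 0 phi0_smooth y.
have gL x y : `|g x - g y| <= C1 / s * \sum_i `|x 0 i - y 0 i|.
  apply: le_trans (lipschitz_of_pderive dphi C1P _ _) _.
  rewrite -mulrA ler_wpM2l// mulr_sumr ler_sum// => i _.
  rewrite !mxE -mulrBr normrM gtr0_norm ?invr_gt0// ler_wpM2l ?invr_ge0 ?(ltW s0)//.
  by have -> : x 0 i - x0 0 i - (y 0 i - x0 0 i) = x 0 i - y 0 i by ring.
have cg : continuous g.
  have c1 : continuous (fun y : 'rV[R]_d => y - x0).
    by move=> z; apply: (@continuousB _ _ _ id (cst x0)); [exact: cvg_id|exact: cst_continuous].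
  have c2 : continuous (fun y : 'rV[R]_d => s^-1 *: y) by exact: scaler_continuous.
  have [c3 _] := phi0_smooth [::].
  move=> z; have c4 := continuous_comp (c1 z) (c2 _).
  exact: (continuous_comp c4 (c3 _)).
have g1 x : `|g x| <= 1 by exact: phi0_le1.
have gS i (x : 'rV[R]_d) : L / 4 <= `|x 0 i| -> g x = 0.
  move=> h; apply: (phi0_supp (i := i)); rewrite !mxE normrM gtr0_norm ?invr_gt0//.
  rewrite ler_pdivlMl// mulr1.
  have := lerB_dist (x 0 i) (x0 0 i); have := x0r i; have := rL; lra.
have Wge0 : 0 <= W.
  apply: le_trans (normc_ge0 _) (@vW 0 _) => i; by rewrite mxE normr0 ltW.
have C1s : 0 <= C1 / s by rewrite mulr_ge0// invr_ge0 ltW.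
have err x : in_box r x -> normc ((g x)%:C -
    \sum_(w : {ffun 'I_d -> 'I_(S ^ 2) * 'I_(S ^ 2)}) grid_coef L g w * cis (dotp x (grid_freq L w)))
    <= C1 / s * (L * d%:R * (10 / S%:R)).
  move=> hx; apply: grid_approx_err => // i; apply: le_trans (hx i) _; have := rL; have := s0; lra.
apply: le_trans (normc_fourier_trig xi r0 vM cg g1 err) _; rewrite lerD2r.
set B := W + _.
have term (w : {ffun 'I_d -> 'I_(S ^ 2) * 'I_(S ^ 2)}) :
    normc (grid_coef L g w) * normc (fourier v (xi - grid_freq L w)) <= B.
  have F0 : 0 <= 2 * M * (2 * r) ^+ d by rewrite !mulr_ge0// exprn_ge0 ?mulr_ge0.
  have sL : 0 < s * Lam by rewrite mulr_gt0.
  case: (pselect (in_box Lam (grid_freq L w))) => [hw|/existsNP[i /negP]].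
    apply: (@le_trans _ _ (1 * W)).
      rewrite ler_pM ?normc_ge0//; [exact: normc_grid_coef_le|exact: vW].
    by rewrite mul1r /B lerDl mulr_ge0// mulr_ge0// exprn_ge0// divr_ge0// ltW.
  rewrite -ltNge => hi.
  have st0 : 0 <= L * (pi / (S ^ 2)%:R).
    by rewrite !mulr_ge0 ?invr_ge0 ?pi_ge0 ?ler0n// ltW.
  have hc := @grid_coef_decay R d (S ^ 2) L N0 L0 w i q g (Cq * s^-1 ^+ q) qS (gS i).
  have {}hc : normc (grid_coef L g w) * `|grid_freq L w 0 i| ^+ q <= Cq * s^-1 ^+ q * 4 ^+ q.
    apply: hc => x; rewrite iter_fdiff_rescale -mulrA -exprMn.
    apply: iter_fdiff_le => [|k y _|y]; last exact: CqP.
      by rewrite mulr_ge0// invr_ge0 ltW.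
    exact: smooth_derivable.
  have hc2 : normc (grid_coef L g w) <= Cq * (4 / (s * Lam)) ^+ q.
    have hp : 0 < Lam ^+ q by rewrite exprn_gt0.
    rewrite -(ler_pM2r hp); apply: le_trans (le_trans hc _).
      by rewrite ler_wpM2l ?normc_ge0// lerXn2r ?nnegrE ?normr_ge0 ?ltW.
    rewrite -!mulrA ler_wpM2l// -!exprMn le_eqVlt; apply/orP; left; apply/eqP.
    by congr (_ ^+ _); field; rewrite !lt0r_neq0.
  apply: (@le_trans _ _ (Cq * (4 / (s * Lam)) ^+ q * (2 * M * (2 * r) ^+ d))).
    by rewrite ler_pM ?normc_ge0//; exact: normc_fourier_le.
  by rewrite /B lerDr.
apply: le_trans (ler_sum _ (fun w _ => term w)) _.
rewrite sumr_const card_ffun card_prod !card_ord -[leLHS]mulr_natl -expnD -expnM.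
by rewrite natrX.
Qed.

End LocalEstimate.

(** * The estimate in powers of one large gauge *)

Section LocalAsymptotics.
Local Open Scope complex_scope.
Variables (R : realType) (d : nat) (phi0 : 'rV[R]_d -> R).
Hypotheses (phi0_test : test_function_unit_ball phi0) (phi0_01 : forall x, 0 <= phi0 x <= 1).

Lemma test_function_eq0 (x : 'rV[R]_d) : 1 <= enorm x -> phi0 x = 0.
Proof.
move=> x1; have [_ [K [_ KB K0]]] := phi0_test; apply: K0 => /KB.
by rewrite /ball_e /= ltNge x1.
Qed.

Lemma nat_between (x : R) : 1 <= x -> exists S : nat, x <= S%:R <= 2 * x.
Proof.
move=> x1; exists (Num.truncn x).+1.
have /andP[h1 h2] := @truncn_itv R x (le_trans ler01 x1).
by rewrite (ltW h2) -natr1 mulrDl mul1r lerD.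
Qed.

(* With [D^-1] a small power of the gauge, all scales of [local_estimate] are powers
   of [D]: the cutoff radius is [D^-4] and the frequency radius [D^6], whose product is
   large, so that the summations by parts gain as many powers of [D] as needed. *)
Lemma local_asymptotic (p n T : nat) : exists B : nat, exists2 D0 : R, 1 <= D0 &
  forall (D : R) (x0 xi : 'rV[R]_d) (v : 'rV[R]_d -> R[i]), D0 <= D ->
    in_box (D ^+ p) x0 -> cbox (D ^+ p) (D ^+ n) v ->
    (forall eta, in_box (D ^+ 6) eta -> normc (fourier v (xi - eta)) <= (D ^+ B)^-1) ->
    normc (fourier (fun x => (rescale (D ^+ 4)^-1 x0 phi0 x)%:C * v x) xi) <= (D ^+ T)^-1.
Proof.
(* With S about D^a, the choice of [a] makes the approximation error O(D^-(T+1)): its summands stand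
   for 1 / s, L, M, the box volume and the target. [B] and [q] pay for the S^(4 d) frequencies, [q]
   also for M and the volume. *)
pose a := (4 + p + n + p * d + T.+1)%N.
pose B := (a * (4 * d) + T.+1)%N.
pose q := (a * (4 * d) + n + p * d + T.+1)%N.
have [sphi [K [cK KB phiK]]] := phi0_test.
have [C1 C10 hC1] := iter_pderive_bounded 1 cK sphi phiK.
have [Cq Cq0 hCq] := iter_pderive_bounded q cK sphi phiK.
pose K1 : R := 160 * C1 * d%:R * 2 ^+ d.
pose K2 : R := 2 ^+ (4 * d).
pose K3 : R := 2 ^+ (4 * d) * Cq * 4 ^+ q * 2 * 2 ^+ d.
have K10 : 0 <= K1 by rewrite !mulr_ge0// exprn_ge0.
have K20 : 0 <= K2 by rewrite exprn_ge0.
have K30 : 0 <= K3 by rewrite !mulr_ge0// exprn_ge0.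
(* The term [2 * q%:R] yields 2 q <= S^2; the three constants are absorbed by the spare factor [D]
   between [T] and [T.+1]. *)
exists B, (1 + 2 * q%:R + K1 + K2 + K3).
  by have := ler0n R q; lra.
move=> D x0 xi v hD hx0 hv hW.
have q0 := ler0n R q.
have D1 : 1 <= D by lra.
have Dp : 0 < D by lra.
have De k : 1 <= D ^+ k by rewrite exprn_ege1.
have Dk k : 0 < D ^+ k by rewrite exprn_gt0.
have [S /andP[S1 S2]] := nat_between (De a).
have SR : 0 < S%:R :> R by apply: lt_le_trans S1.
have S0 : (0 < S)%N by rewrite -(ltr_nat R).
have qS : (2 * q <= S ^ 2)%N.
  rewrite -(ler_nat R) natrX natrM.
  have Da : D <= D ^+ a by rewrite ler_eXnr// /a.
  have : 2 * q%:R <= S%:R :> R by apply: le_trans S1; apply: le_trans Da; lra.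
  move=> /le_trans; apply; rewrite expr2 ler_peMl ?ler0n//.
  by apply: le_trans S1.
have r0 : 0 <= D ^+ p by exact: ltW.
(* This fixes L = 8 D^p: the support box, widened by the cutoff radius, stays within L / 4. *)
have rL : D ^+ p + (D ^+ 4)^-1 <= 8 * D ^+ p / 4.
  have : (D ^+ 4)^-1 <= 1 by rewrite invf_le1.
  by have := De p; lra.
have s0 : 0 < (D ^+ 4)^-1 by rewrite invr_gt0.
have phi_le1 x : `|phi0 x| <= 1.
  by have /andP[h0 h1] := phi0_01 x; rewrite ger0_norm.
have phi_supp (x : 'rV[R]_d) i : 1 <= `|x 0 i| -> phi0 x = 0.
  by move=> h; apply: test_function_eq0; apply: (le_trans h); exact: coord_le_enorm.
have := local_estimate sphi phi_le1 phi_supp hC1 hCq S0 qS s0 r0 rL hx0 hv (Dk 6) hW C10 Cq0.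
move=> /le_trans; apply.
have SV : S%:R^-1 <= (D ^+ a)^-1 by rewrite lef_pV2 ?posrE.
have SX : S%:R ^+ (4 * d) <= 2 ^+ (4 * d) * D ^+ (a * (4 * d)).
  have H : 0 <= 2 * D ^+ a by rewrite mulr_ge0 ?(ltW (Dk a)).
  by rewrite (exprM D) -exprMn; apply: lerXn2r; rewrite ?nnegrE ?ler0n.
have DE k : D ^+ k != 0 by rewrite lt0r_neq0.
have D0 : D != 0 by rewrite lt0r_neq0.
have rE : (2 * D ^+ p) ^+ d = 2 ^+ d * D ^+ (p * d) by rewrite exprMn -exprM.
have err : 2 * (C1 / (D ^+ 4)^-1 * (8 * D ^+ p * d%:R * (10 / S%:R)) * D ^+ n) * (2 * D ^+ p) ^+ d
    <= K1 / D ^+ T.+1.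
  pose X := 2 * (C1 * D ^+ 4 * (8 * D ^+ p * d%:R * 10) * D ^+ n) * (2 ^+ d * D ^+ (p * d)).
  have X0 : 0 <= X by rewrite /X !mulr_ge0// ?exprn_ge0// ltW.
  have -> : K1 / D ^+ T.+1 = X * (D ^+ a)^-1.
    by rewrite /X /K1 /a !exprD; field; rewrite !DE.
  apply: le_trans (ler_wpM2l X0 SV); rewrite rE /X le_eqVlt; apply/orP; left; apply/eqP.
  by field; rewrite !lt0r_neq0.
have t1 : S%:R ^+ (4 * d) * (D ^+ B)^-1 <= K2 / D ^+ T.+1.
  apply: le_trans (ler_wpM2r _ SX) _; first by rewrite invr_ge0 ltW.
  by rewrite /B /K2 exprD le_eqVlt; apply/orP; left; apply/eqP; field; rewrite !DE.
have t2 : S%:R ^+ (4 * d) * (Cq * (4 / ((D ^+ 4)^-1 * D ^+ 6)) ^+ q * (2 * D ^+ n * (2 * D ^+ p) ^+ d))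
   <= K3 / D ^+ T.+1.
  have e1 : (4 / ((D ^+ 4)^-1 * D ^+ 6)) ^+ q <= 4 ^+ q / D ^+ q.
    have -> : (D ^+ 4)^-1 * D ^+ 6 = D ^+ 2 by field.
    rewrite -expr_div_n; apply: lerXn2r; rewrite ?nnegrE ?divr_ge0 ?(ltW Dp) ?(ltW (Dk 2))//.
    by rewrite ler_pM2l// lef_pV2 ?posrE// ler_eXnr.
  rewrite rE; have X0 : 0 <= 2 * D ^+ n * (2 ^+ d * D ^+ (p * d)).
    by rewrite !mulr_ge0// ?exprn_ge0// ltW.
  apply: (@le_trans _ _ (2 ^+ (4 * d) * D ^+ (a * (4 * d)) *
     (Cq * (4 ^+ q / D ^+ q) * (2 * D ^+ n * (2 ^+ d * D ^+ (p * d)))))).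
    apply: ler_pM => //.
      apply: mulr_ge0 => //; apply: mulr_ge0 => //; apply: exprn_ge0.
      by rewrite divr_ge0// mulr_ge0 ?invr_ge0 ?(ltW (Dk _)).
    by rewrite ler_wpM2r// ler_wpM2l.
  rewrite /K3 le_eqVlt; apply/orP; left; apply/eqP.
  have -> : D ^+ q = D ^+ (a * (4 * d)) * D ^+ n * D ^+ (p * d) * D ^+ T.+1 by rewrite /q !exprD.
  by field; rewrite !DE.
rewrite mulrDr.
have fin : (K1 + K2 + K3) / D ^+ T.+1 <= (D ^+ T)^-1.
  by rewrite ler_pdivrMr// exprSr mulrA mulVf// mul1r; lra.
apply: le_trans (lerD (lerD t1 t2) err) (le_trans _ fin).
by rewrite -!mulrDl addrC addrA.
Qed.

End LocalAsymptotics.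

(** * Uniformity and overspill for germs *)

Section Germs.
Variable R : realType.
Local Notation I := (eps_index R).
Implicit Types (e : I) (P Q : I -> Prop).

Lemma eps_gt0 e : 0 < sval e.
Proof. by case: e => /= x /andP[]. Qed.

Lemma eps_le1 e : sval e <= 1.
Proof. by case: e => /= x /andP[]. Qed.

Lemma for_small_le (a : R) : 0 < a -> for_small (fun e => sval e <= a).
Proof. by move=> a0; exists a. Qed.

Lemma for_small_ge_inv (a : R) : for_small (fun e => a <= (sval e)^-1).
Proof.
apply: (@for_smallS _ (fun e => sval e <= (`|a| + 1)^-1)).
  move=> e h; apply: (@le_trans _ _ (`|a| + 1)); first by rewrite ler_wpDr// ler_norm.
  by rewrite -[leLHS]invrK lef_pV2 ?posrE ?invr_gt0 ?eps_gt0// ltr_wpDl.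
by apply: for_small_le; rewrite invr_gt0 ltr_wpDl.
Qed.

Lemma for_small_ex P : for_small P -> exists e, P e.
Proof.
move=> [a a0 h]; have h1 : 0 < Num.min a 1 <= 1 by rewrite lt_min a0 ltr01 ge_min lexx orbT.
by exists (exist _ (Num.min a 1) h1); apply: h => /=; rewrite ge_min lexx.
Qed.

(* A relation holding along every germ holds uniformly: otherwise pick a
   counterexample at each index that has one. *)
Lemma for_small_select (T : Type) (A B : I -> T -> Prop) :
  for_small (fun e => exists t, A e t) ->
  (forall x : I -> T, for_small (fun e => A e (x e)) -> for_small (fun e => B e (x e))) ->
  for_small (fun e => forall t, A e t -> B e t).
Proof.
move=> nA h; have [e0 [t0 _]] := for_small_ex nA.
have sel e : exists t, ((exists t', A e t') -> A e t) /\
    ((exists2 t', A e t' & ~ B e t') -> ~ B e t).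
  case: (pselect (exists2 t', A e t' & ~ B e t')) => [[t At Bt]|nB].
    by exists t.
  case: (pselect (exists t', A e t')) => [[t At]|nAe]; first by exists t.
  by exists t0.
have [x hx] := choice sel.
have hA : for_small (fun e => A e (x e)) by apply: for_smallS nA => e; exact: (hx e).1.
apply: for_smallS (h x hA) => e Bx t At; apply: contrapT => nB.
by apply: ((hx e).2 _) Bx; exists t.
Qed.

(** Take the largest [n <= 1 / eps] with [P n e]. The cap guarantees that it exists, and still tends
    to infinity as eps shrinks. *)
Lemma last_below (P : nat -> I -> Prop) : exists k : I -> nat,
  forall e n, P n e -> n%:R <= (sval e)^-1 -> P (k e) e /\ (n <= k e)%N.
Proof.
suff h e : exists k, forall n, P n e -> n%:R <= (sval e)^-1 -> P k e /\ (n <= k)%N.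
  by have [k hk] := choice h; exists k.
case: (pselect (exists n, P n e /\ n%:R <= (sval e)^-1)) => [ex|nex]; last first.
  by exists 0%N => n Pn ne; exfalso; apply: nex; exists n.
pose Q n := `[< P n e /\ n%:R <= (sval e)^-1 >].
have exQ : exists n, Q n by case: ex => n h; exists n; exact/asboolP.
have bQ n : Q n -> (n <= Num.truncn (sval e)^-1)%N.
  by move=> /asboolP[_ h]; rewrite truncn_ge_nat // invr_ge0 ltW // eps_gt0.
exists (ex_maxn exQ bQ) => n Pn ne; case: ex_maxnP => k /asboolP[Pk _] kmax.
by split => //; apply: kmax; exact/asboolP.
Qed.

Lemma overspill (P : nat -> I -> Prop) : (forall n, for_small (P n)) ->
  exists2 k : I -> nat, for_small (fun e => P (k e) e) &
    forall n, for_small (fun e => (n <= k e)%N).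
Proof.
move=> hP; have [k hk] := last_below P; exists k.
  apply: for_smallS (for_smallI (hP 0%N) (for_small_ge_inv 0)) => e [P0 e0].
  by have [] := hk e 0%N P0 e0.
move=> n; apply: for_smallS (for_smallI (hP n) (for_small_ge_inv n%:R)) => e [Pn en].
by have [] := hk e n Pn en.
Qed.

(** Let [k e] be the largest exponent up to 1 / eps that is violated at [e], and [x e] a point
    violating it. An exponent [N] valid along the germ [x] then works everywhere: were it violated
    at [e], then [N <= k e], against the choice of [x]. *)
Lemma moderate_uniform (T : Type) (t0 : T) (f : I -> T -> R) :
  (forall x : I -> T, exists N : nat, for_small (fun e => f e (x e) <= (sval e)^-1 ^+ N)) ->
  exists N : nat, for_small (fun e => forall t, f e t <= (sval e)^-1 ^+ N).
Proof.
move=> h; pose P n e := exists t, (sval e)^-1 ^+ n < f e t.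
have [k hk] := last_below P.
have wit e : exists t, P (k e) e -> (sval e)^-1 ^+ k e < f e t.
  by case: (pselect (P (k e) e)) => [[t ht]|n]; [exists t|exists t0].
have [x hx] := choice wit; have [N hN] := h x; exists N.
apply: for_smallS (for_smallI hN (for_small_ge_inv N%:R)) => e [eN Ne] t.
rewrite leNgt; apply/negP => ft.
have [Pk Nk] : P (k e) e /\ (N <= k e)%N by apply: hk => //; exists t.
have := lt_le_trans (hx e Pk) eN; rewrite ltNge ler_weXn2l//.
by rewrite invf_ge1 ?eps_gt0 ?eps_le1.
Qed.

Lemma mem_hset (A : Type) (b : I -> set A) (x : I -> A) :
  hset (cls b) (cls x) <-> for_small (fun e => b e (x e)).
Proof. exact: hrelE. Qed.

Lemma mem_hstar (A : Type) (b : set A) (x : I -> A) :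
  hstar b (cls x) <-> for_small (fun e => b (x e)).
Proof. exact: hrelE. Qed.

Lemma internalP (A : Type) (X : set (hyper R A)) : internal X ->
  exists2 b : I -> set A, for_small (fun e => b e !=set0) &
    forall x, X (cls x) <-> for_small (fun e => b e (x e)).
Proof.
move=> [B nB ->]; exists (rep B) => // x.
by rewrite -{1}(repK B); exact: mem_hset.
Qed.

End Germs.

(** * The notions expressed on representatives *)

Section MicrolocalGerms.
Local Open Scope complex_scope.
Variables (R : realType) (d : nat).
Local Notation I := (eps_index R).
Local Notation E := 'rV[R]_d.
Implicit Types (e : I) (x y : I -> E) (u v : I -> E -> R[i]).

(** Selecting germs of pairs (t, z) turns closure under positive generalized scalars into closure of
    the sets [c e] under positive reals. *)
Lemma cone_uniform (c : I -> set E) (Gamma : set (hyper R E)) : cone Gamma ->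
  for_small (fun e => c e !=set0) ->
  (forall x, Gamma (cls x) <-> for_small (fun e => c e (x e))) ->
  for_small (fun e => forall (t : R) z, 0 < t -> c e z -> c e (t *: z)).
Proof.
move=> cG c0 cP.
have := @for_small_select R (R * E)%type (fun e p => 0 < p.1 /\ c e p.2)
  (fun e p => c e (p.1 *: p.2)).
move=> /(_ _ _)/for_smallS; apply.
- by move=> e h t z t0 cz; exact: (h (t, z) (conj t0 cz)).
- by apply: for_smallS c0 => e [z cz]; exists (1, z).
- move=> x hx.
  have /cP h : Gamma (cls (fun e => (x e).2)) by apply/cP; apply: for_smallS hx => e [].
  have : Gamma (hscale (cls (fun e => (x e).1)) (cls (fun e => (x e).2))).
    by apply: cG; [apply/hrelE; apply: for_smallS hx => e []|apply/cP].
  by rewrite /hscale hmap2E => /cP.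
Qed.

Lemma rho_powE (a : R) : rho_pow a = cls (fun e => sval e `^ a).
Proof. by rewrite /rho_pow /rho hmapE. Qed.

Lemma powR_epsN (n : nat) e : sval e `^ (- n%:R) = (sval e)^-1 ^+ n.
Proof. by rewrite powRN powR_mulrn ?ltW ?eps_gt0// exprVn. Qed.

Lemma fast_scaleP x : fast_scale (cls x) <->
  exists2 a : R, 0 < a & for_small (fun e => sval e `^ (- a) <= enorm (x e)).
Proof.
by split=> -[a a0 h]; exists a => //; move: h; rewrite rho_powE /hnorm hmapE /hle;
  rewrite hrelE.
Qed.

Lemma fast_nearP x y : fast_near (cls x) (cls y) <->
  exists2 a : R, 0 < a & for_small (fun e => enorm (x e - y e) <= sval e `^ a).
Proof.
by split=> -[a a0 h]; exists a => //; move: h;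
  rewrite rho_powE /hnorm /hsub hmap2E hmapE /hle hrelE.
Qed.

Lemma hdirE x : hdir (cls x) = cls (fun e => (enorm (x e))^-1 *: x e).
Proof. exact: hmapE. Qed.

Lemma hnegligibleP (z : I -> R[i]) : hnegligible (cls z) <->
  forall n : nat, for_small (fun e => normc (z e) <= sval e ^+ n).
Proof.
split=> h n; have := h n; rewrite rho_powE hmapE /hle hrelE; apply: for_smallS => e;
  by rewrite powR_mulrn// ltW// eps_gt0.
Qed.

Lemma hmoderateP (z : I -> R[i]) : hmoderate (cls z) <->
  exists n : nat, for_small (fun e => normc (z e) <= (sval e)^-1 ^+ n).
Proof.
split=> -[n h]; exists n; move: h; rewrite rho_powE hmapE /hle hrelE;
  by apply: for_smallS => e; rewrite powR_epsN.
Qed.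

Lemma happE (A B : Type) (f : I -> A -> B) (x : I -> A) :
  happ (cls f) (cls x) = cls (fun e => f e (x e)).
Proof. exact: hmap2E. Qed.

Lemma mderive0 (f : E -> R) : mderive (fun=> 0%N) f = f.
Proof. by rewrite /mderive; elim: (enum _). Qed.

Lemma cmderive0 (f : E -> R[i]) : cmderive (fun=> 0%N) f = f.
Proof. by apply/funext => x; rewrite /cmderive !mderive0; case: (f x). Qed.

Lemma hcompactly_in_box (Omega : set E) y : hcompactly Omega (cls y) ->
  for_small (fun e => in_box (sval e)^-1 (y e)).
Proof.
move=> [K [cK _ _ /mem_hstar yK]].
have [M [_ hM]] := compact_bounded cK.
apply: for_smallS (for_smallI yK (for_small_ge_inv (`|M| + 1))) => e [Ky eM] i.
apply: le_trans (eM); apply: (@le_trans _ _ `|y e|); last first.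
  by apply: hM => //; rewrite (le_lt_trans (ler_norm M))// ltrDl.
rewrite [X in _ <= X]/Num.norm /= mx_normrE.
exact: (@le_bigmax _ _ _ _ (fun ij : 'I_1 * 'I_d => `|y e ij.1 ij.2|) (0, i)).
Qed.

End MicrolocalGerms.

(** * Decay along one germ of points and covectors *)

Section RegularGerms.
Local Open Scope complex_scope.
Variables (R : realType) (d : nat).
Local Notation I := (eps_index R).
Local Notation E := 'rV[R]_d.
Implicit Types (e : I) (x y : I -> E) (u v : I -> E -> R[i]).

(** The gauge [D] of [local_asymptotic] as a function of eps; all scales become its integral
    powers. *)
Definition eps_root (k : nat) e : R := (sval e `^ k%:R^-1)^-1.

Lemma eps_root_gt0 k e : 0 < eps_root k e.
Proof. by rewrite invr_gt0 powR_gt0 ?eps_gt0. Qed.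

Lemma powR_root k j e : sval e `^ (- (j%:R / k%:R)) = eps_root k e ^+ j.
Proof. by rewrite powRN mulrC powRrM powR_mulrn ?powR_ge0// exprVn. Qed.

Lemma rootX k e : (0 < k)%N -> eps_root k e ^+ k = (sval e)^-1.
Proof. by move=> k0; rewrite -powR_root divff ?pnatr_eq0 -?lt0n// powRN powRr1// ltW ?eps_gt0. Qed.

Lemma for_small_ge_root k (a : R) : (0 < k)%N -> for_small (fun e => a <= eps_root k e).
Proof.
move=> k0; apply: for_smallS (for_small_ge_inv (`|a| ^+ k)) => e.
rewrite -(rootX e k0) => h; apply: le_trans (ler_norm a) _.
by rewrite -(ler_pXn2r k0) ?nnegrE ?(ltW (eps_root_gt0 _ _)).
Qed.

(** Bounds known along every germ become a sup bound and a support box for each small eps, as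
    [local_asymptotic] expects. *)
Lemma Mcfun_uniform (Omega : set E) v : (0 < d)%N -> Mcfun (hcompactly Omega) (cls v) ->
  exists N, for_small (fun e => cbox (sval e)^-1 ((sval e)^-1 ^+ N) (v e)).
Proof.
move=> d0 [[/hpredE sv mv] [K0]]; rewrite -(repK K0); move: (rep K0) => K [/hpredE cK KO v0].
have [N hN] : exists N : nat, for_small (fun e => forall t, normc (v e t) <= (sval e)^-1 ^+ N).
  apply: (moderate_uniform 0) => x; apply/hmoderateP; rewrite -happE.
  have := mv (fun=> 0%N) (cls x) Logic.I; rewrite hmapE !happE.
  by congr hmoderate; congr cls; apply/funext => e; rewrite cmderive0.
have bK : for_small (fun e => forall z, K e z -> in_box (sval e)^-1 z).
  apply: for_small_select; first by apply: for_smallS cK => e [].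
  by move=> y /mem_hset/KO; exact: hcompactly_in_box.
have oK : for_small (fun e => forall z, ~ K e z -> v e z = 0).
  apply: for_small_select.
    apply: for_smallS bK => e bK.
    (* Selection requires a point off [K e]; taking one off the box uses a coordinate, hence
       [0 < d]. *)
    exists (const_mx ((sval e)^-1 + 1)) => /bK/(_ (Ordinal d0)).
    rewrite mxE ger0_norm; last by rewrite addr_ge0// invr_ge0 ltW ?eps_gt0.
    by rewrite gerDl ler10.
  move=> y hy; have := v0 (cls y); rewrite happE; move=> /(_ _)/cls_eqP; apply => a.
  rewrite -(repK a); move: (rep a) => {}a /mem_hset ha.
  rewrite /hnorm /hsub hmap2E hmapE; apply/hrelE.
  apply: for_smallS (for_smallI hy ha) => e [ny ya].
  rewrite lt_neqAle enorm_ge0 andbT eq_sym; apply/eqP => /enorm_eq0/eqP.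
  by rewrite subr_eq0 => /eqP ye; apply: ny; rewrite ye.
exists N; apply: for_smallS (for_smallI (for_smallI hN sv) (for_smallI bK oK)) => e.
move=> [[vN [/(_ [::])[c1 _] /(_ [::])[c2 _]]] [Kb K0']]; split=> // y ny.
by apply: K0' => /Kb.
Qed.

Variable phi0 : E -> R.
Hypotheses (phi0_test : test_function_unit_ball phi0) (phi0_01 : forall z, 0 <= phi0 z <= 1).

(** In the gauge D = eps^(-1/(4 m)) one has |xi| >= D^8, while the small frequencies eta have size
    about D^6. So xi - eta has norm at least D^7 and direction within D^-1 of that of xi, where the
    regularity of [v] applies. *)
Lemma regular_decay (Omega : set E) u x (xi : I -> E) (m : nat) : (0 < m)%N ->
  hcompactly Omega (cls x) -> for_small (fun e => xi e != 0) ->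
  for_small (fun e => sval e `^ (- (2 / m%:R)) <= enorm (xi e)) ->
  microlocally_regular Omega (cls u) (cls x) (hdir (cls xi)) ->
  for_small (fun e => normc (fourier
    (fun X => (rescale (sval e `^ m%:R^-1) (x e) phi0 X)%:C * u e X) (xi e)) <= sval e ^+ m).
Proof.
move=> m0 xO xi0 xim [v0]; rewrite -(repK v0); move: (rep v0) => v [vM uv vF].
have d0 : (0 < d)%N.
  have [e] := for_small_ex xi0; rewrite lt0n; apply: contra_neqN => /eqP d0.
  by apply/rowP => i; exfalso; have := ltn_ord i; rewrite [X in (_ < X)%N]d0.
pose p := (4 * m)%N; have p0 : (0 < p)%N by rewrite muln_gt0.
have [N vN] := Mcfun_uniform d0 vM.
(* As D^p = 1 / eps, these parameters encode support in a box of size 1 / eps, the sup bound eps^-N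
   and the target eps^m. *)
have [B [D0 D01 hD]] := local_asymptotic phi0_test phi0_01 p (p * N) (p * m).
have xi1 : for_small (fun e => 0 < enorm (xi e)).
  apply: for_smallS xi0 => e h; rewrite lt_neqAle enorm_ge0 andbT eq_sym.
  by apply: contra_neq h; exact: enorm_eq0.
have mE e : sval e `^ m%:R^-1 = (eps_root p e ^+ 4)^-1.
  rewrite -powR_root powRN invrK /p natrM; congr (_ `^ _).
  by field; rewrite pnatr_eq0 -lt0n.
have m2E e : sval e `^ (- (2 / m%:R)) = eps_root p e ^+ 8.
  rewrite -powR_root /p natrM; congr (_ `^ - _).
  by field; rewrite pnatr_eq0 -lt0n.
(* Agreement at fast-near points becomes agreement on the whole ball that supports the cutoff. *)
have huv : for_small (fun e => forall X, enorm (X - x e) <= sval e `^ m%:R^-1 -> u e X = v e X).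
  apply: for_small_select.
    apply: for_smallS (for_small_ge_inv 0) => e _; exists (x e).
    by rewrite subrr /enorm /dotp big1 ?sqrtr0 ?powR_ge0// => i _; rewrite mxE mulr0.
  move=> X hX; apply/cls_eqP; rewrite -!happE; apply: uv; apply/fast_nearP.
  by exists m%:R^-1 => //; rewrite invr_gt0 ltr0n.
pose dir z : E := (enorm z)^-1 *: z.
have hvF : for_small (fun e => forall z, eps_root p e ^+ 7 <= enorm z /\
    enorm (dir z - dir (xi e)) <= (eps_root p e)^-1 -> normc (fourier (v e) z) <= sval e ^+ B).
  apply: for_small_select.
    (* The point of norm D^7 in the direction of xi shows that the truncated cone is nonempty. *)
    apply: for_smallS xi1 => e h; exists (eps_root p e ^+ 7 *: dir (xi e)).
    have r0 : 0 < eps_root p e ^+ 7 by rewrite exprn_gt0// eps_root_gt0.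
    have dn : enorm (dir (xi e)) = 1.
      by rewrite enormZ gtr0_norm ?invr_gt0// mulVf// gt_eqF.
    have tn : enorm (eps_root p e ^+ 7 *: dir (xi e)) = eps_root p e ^+ 7.
      by rewrite enormZ dn mulr1 gtr0_norm.
    split; first by rewrite tn.
    rewrite {1}/dir tn scalerA mulVf ?gt_eqF// scale1r subrr.
    rewrite /enorm /dotp big1 ?sqrtr0 ?invr_ge0 ?powR_ge0// => i _.
    by rewrite mxE mulr0.
  move=> z hz; have := vF (cls z); rewrite /hfourier hmapE happE => H.
  have {}H : hnegligible (cls (fun e => fourier (v e) (z e))).
    apply: H.
      apply/fast_scaleP; exists (7 / p%:R); first by rewrite divr_gt0// ltr0n.
      by apply: for_smallS hz => e [h _]; rewrite powR_root.
    rewrite !hdirE; apply/fast_nearP; exists (1%:R / p%:R); first by rewrite divr_gt0// ltr0n.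
    apply: for_smallS hz => e [_ h]; rewrite -[leRHS]invrK -powRN powR_root expr1.
    exact: h.
  by move/hnegligibleP: H; exact.
have xb := hcompactly_in_box xO.
(* The bound 2 d + 2 covers the dimensional factor in [enorm_le_box] and the factors 2 in [D87] and
   [d67]. *)
have big := for_small_ge_root (Num.max D0 (2 * d%:R + 2)) p0.
apply: for_smallS (for_smallI (for_smallI (for_smallI vN huv) (for_smallI hvF xb))
  (for_smallI (for_smallI big xi1) xim)) => e.
rewrite m2E => -[[[vc uve] [vFe xe]] [[De xe0] xie]].
set D := eps_root p e in vFe De xie.
have DX : D ^+ p = (sval e)^-1 by exact: rootX.
have [DD0 Dd] : D0 <= D /\ 2 * d%:R + 2 <= D by move: De; rewrite ge_max => /andP[].
have d1 := ler0n R d.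
have D2 : 1 <= D by lra.
have Dp : 0 < D by lra.
have Dk k : 0 < D ^+ k by rewrite exprn_gt0.
have -> : (fun X => (rescale (sval e `^ m%:R^-1) (x e) phi0 X)%:C * u e X) =
  (fun X => (rescale (D ^+ 4)^-1 (x e) phi0 X)%:C * v e X).
  apply/funext => X; rewrite mE -/D.
  have [h|h] := leP (enorm (X - x e)) (sval e `^ m%:R^-1); first by rewrite uve.
  rewrite /rescale test_function_eq0// ?mul0r//.
  rewrite enormZ invrK gtr0_norm//; move: h; rewrite mE -/D => /ltW h.
  by rewrite -(mulfV (lt0r_neq0 (Dk 4))) ler_pM2l.
have -> : sval e ^+ m = (D ^+ (p * m))^-1 by rewrite exprM DX exprVn invrK.
apply: hD => //.
- by rewrite DX.
- by rewrite exprM DX.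
move=> eta heta.
have etan : enorm eta <= d%:R * D ^+ 6 by apply: enorm_le_box => //; exact: ltW.
have D87 : 2 * D ^+ 7 <= D ^+ 8 by rewrite (exprS D 7) ler_pM2r//; lra.
have d67 : 2 * (d%:R * D ^+ 6) <= D ^+ 7.
  by rewrite (exprS D 6) mulrA ler_pM2r//; lra.
have zn : D ^+ 7 <= enorm (xi e - eta).
  have := enormD (xi e - eta) eta; rewrite subrK; lra.
apply: (@le_trans _ _ (sval e ^+ B)).
  apply: vFe; split=> //; apply: le_trans (enorm_dirB _ _) _.
  - by apply: contraTneq xe0 => ->; rewrite /enorm /dotp big1 ?sqrtr0 ?ltxx// => i _; rewrite mxE mulr0.
  - apply: contraTneq (lt_le_trans (Dk 7) zn) => ->.
    by rewrite /enorm /dotp big1 ?sqrtr0 ?ltxx// => i _; rewrite mxE mulr0.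
  rewrite ler_pdivrMr// ler_pdivlMl//.
  have : D * (2 * enorm eta) <= D * D ^+ 7 by rewrite ler_pM2l//; lra.
  by rewrite -exprS; lra.
rewrite -[leLHS]invrK -exprVn -DX lef_pV2 ?posrE//; last by rewrite -exprM.
by rewrite -exprM ler_weXn2l// leq_pmull.
Qed.

End RegularGerms.

(** * Uniformity in (x, xi) and the choice of k *)

Theorem theorem7p2 (R : realType) (d : nat) (phi0 : 'rV[R]_d -> R)
    (phi0_test : test_function_unit_ball phi0)
    (phi0_01 : forall x, 0 <= phi0 x <= 1)
    (phi0_1 : forall x, ball_e (2^-1) x -> phi0 x = 1)
    (Omega : set 'rV[R]_d) (Omega_open : open Omega)
    (V : set (hyper R 'rV[R]_d)) (V_internal : internal V)
    (V_Omega : V `<=` hcompactly Omega)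
    (Gamma : set (hyper R 'rV[R]_d)) (Gamma_internal : internal Gamma)
    (Gamma_cone : cone Gamma)
    (u : hyper R ('rV[R]_d -> R[i])) (u_M : Mfun (hcompactly Omega) u)
    (u_reg : forall x0 xi0 : hyper R 'rV[R]_d,
       V x0 -> hstar (@sphere_e R d) xi0 -> Gamma xi0 ->
       microlocally_regular Omega u x0 xi0) :
  exists2 k : hyper R nat, hnat_infty k &
    forall x xi : hyper R 'rV[R]_d,
      V x -> Gamma xi -> fast_scale xi ->
      hnegligible (happ (hfourier (hmulf (cutoff phi0 k x) u)) xi).
Proof.
have [b b0 bV] := internalP V_internal.
have [c c0 cG] := internalP Gamma_internal.
have cc := cone_uniform Gamma_cone c0 cG.
pose u' := rep u; have uE : u = cls u' by rewrite repK.
pose F m e x z := Normc.normc (fourier (fun X =>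
  real_complex R (rescale (sval e `^ m%:R^-1) x phi0 X) * u' e X) z).
(* The guard makes [P 0] vacuous: at m = 0 the inverse is 0 by convention, and no estimate is
   claimed. *)
pose P m (e : eps_index R) := (0 < m)%N -> forall x z, b e x -> c e z ->
  sval e `^ (- (2 / m%:R)) <= enorm z -> F m e x z <= sval e ^+ m.
(* Selection needs a covector of the required size in Gamma; if Gamma has none at fast scale, the
   conclusion is vacuous and any infinite [k] serves. *)
have hP : (exists2 xi, Gamma (cls xi) & fast_scale (cls xi)) -> forall m, for_small (P m).
  move=> [xi1 /cG G1 /fast_scaleP[a a0 ha]] m.
  have [->|m0] := posnP m; first by apply: for_smallS b0.
  suff : for_small (fun e => forall p : 'rV[R]_d * 'rV[R]_d,
      [/\ b e p.1, c e p.2 & sval e `^ (- (2 / m%:R)) <= enorm p.2] ->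
      F m e p.1 p.2 <= sval e ^+ m).
    by apply: for_smallS => e h _ x z bx cz hz; exact: (h (x, z)).
  apply: for_small_select.
    apply: for_smallS (for_smallI (for_smallI b0 cc) (for_smallI G1 ha)).
    move=> e [[[x bx] ce] [cz hz]].
    have z0 : 0 < enorm (xi1 e) by apply: lt_le_trans hz; rewrite powR_gt0 ?eps_gt0.
    have s0 : 0 < sval e `^ (- (2 / m%:R)) by rewrite powR_gt0 ?eps_gt0.
    (* The fast-scale element is rescaled, within the cone, to norm exactly eps^(-2/m). *)
    exists (x, (sval e `^ (- (2 / m%:R)) / enorm (xi1 e)) *: xi1 e); split=> //=.
      by apply: ce => //; rewrite divr_gt0.
    by rewrite enormZ gtr0_norm ?divr_gt0// divfK ?gt_eqF.
  move=> p hp; pose x e := (p e).1; pose z e := (p e).2.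
  have Vx : V (cls x) by apply/bV; apply: for_smallS hp => e [].
  have z1 : for_small (fun e => 0 < enorm (z e)).
    apply: for_smallS hp => e [_ _]; apply: lt_le_trans.
    by rewrite powR_gt0 ?eps_gt0.
  apply: (regular_decay phi0_test phi0_01 (Omega := Omega) (u := u') (x := x) (xi := z)) => //.
  - exact: V_Omega.
  - apply: for_smallS z1 => e; apply: contraTneq => ->.
    by rewrite /enorm /dotp big1 ?sqrtr0 ?ltxx// => i _; rewrite mxE mulr0.
  - by apply: for_smallS hp => e [].
  - rewrite -uE; apply: u_reg => //; rewrite hdirE.
      apply/mem_hstar; apply: for_smallS z1 => e h; rewrite /sphere_e /= enormZ.
      by rewrite gtr0_norm ?invr_gt0// mulVf// gt_eqF.
    apply/cG; apply: for_smallS (for_smallI (for_smallI hp cc) z1).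
    by move=> e [[[_ cz _] ce] h]; apply: ce => //; rewrite invr_gt0.
have [k kP kinf] : exists2 k : eps_index R -> nat,
    (exists2 xi, Gamma (cls xi) & fast_scale (cls xi)) -> for_small (fun e => P (k e) e) &
    forall n, for_small (fun e => (n <= k e)%N).
  case: (pselect (exists2 xi, Gamma (cls xi) & fast_scale (cls xi))) => [h|h].
    by have [k k1 k2] := overspill (hP h); exists k.
  have [k _ k2] := @overspill R (fun _ _ => True) (fun=> for_smallT (fun=> I)).
  by exists k.
exists (cls k); first by move=> n; apply/hrelE; exact: kinf.
move=> x xi; rewrite -(repK x) -(repK xi); move: (rep x) (rep xi) => {}x {}xi Vx Gx fx.
have kP' : for_small (fun e => P (k e) e) by apply: kP; exists xi.
move: Vx Gx fx => /bV bx /cG cx /fast_scaleP[a a0 ha].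
have cutE : cutoff phi0 (cls k) (cls x) =
    cls (fun e => rescale (sval e `^ (k e)%:R^-1) (x e) phi0).
  by rewrite /cutoff /rho_root /rho [hmap2 _ _ (cls k)]hmap2E hmap2E.
rewrite uE cutE /hmulf hmap2E /hfourier hmapE happE.
apply/hnegligibleP => n.
(* From this index on 2 / k <= a, so a covector of norm at least eps^(-a) falls under [P (k e)]. *)
have ka := kinf (Num.truncn (2 / a)).+1.
apply: for_smallS (for_smallI (for_smallI kP' ka) (for_smallI (kinf n) (for_smallI bx (for_smallI cx ha)))).
move=> e [[Pe kae] [nk [be [ce he]]]].
have k0 : (0 < k e)%N by apply: leq_trans kae.
have h : 2 / (k e)%:R <= a.
  rewrite ler_pdivrMr ?ltr0n// mulrC -ler_pdivrMr//.
  apply: (@le_trans _ _ (Num.truncn (2 / a)).+1%:R); last by rewrite ler_nat.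
  by apply: ltW; have /andP[] := @truncn_itv R (2 / a) (ltW (divr_gt0 (ltr0Sn R 1) a0)).
apply: (@le_trans _ _ (sval e ^+ k e)); last first.
  by rewrite ler_wiXn2l// ?eps_le1// ltW// eps_gt0.
apply: (Pe k0) => //; apply: le_trans he; rewrite !powRN lef_pV2 ?posrE ?powR_gt0 ?eps_gt0//.
have := eps_le1 e; rewrite le_eqVlt => /orP[/eqP ->|e1]; first by rewrite !powR1.
by rewrite /powR gt_eqF ?eps_gt0// ler_expR ler_wnM2r// ln_le0// ltW.
Qed.
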